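(* Let $A$ be a finite tuple of polytopes in $\mathbb R^n$. Every essential facing $E$ of $A$ is adjacent to another essential facing $E'$ of $A$ such that $\dim E'=\dim E+1$.
   Context: Let $K$ be a finite set and $A=(A(i))_{i\in K}$ a tuple of polytopes in $\mathbb R^n$. For $J\subset K$, $AJ=(A(i))_{i\in J}$ is a subtuple of $A$; $\sum A$ is the Minkowski sum of all $A(i)$, $i\in K$ (equal to $\{0\}$ for $K=\varnothing$); $\dim A=\dim(\sum A)-|K|$; $\min\dim A=\min_{J\subset K}\dim AJ\le0$. The tuple $A$ is essential if $\dim AJ=\min\dim A$ only for $J=K$. Every tuple has a unique maximal (with respect to inclusion of index sets) essential subtuple; it may be the empty tuple. A $K$-tuple $B$ is a face of $A$, written $B\prec A$, if $B(i)$ is a face of $A(i)$ for every $i\in K$ and $\sum B$ is a face of $\sum A$ (in particular $A\prec A$). A tuple $E$ is an essential facing of $A$ if it is the maximal essential subtuple of some face $B\prec A$. An essential facing $E$ is adjacent to an essential facing $E'$ if there are faces $B\prec B'\prec A$ such that $E$ and $E'$ are the maximal essential subtuples of $B$ and $B'$ respectively.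
   Formalization: The formal theorem assumes in addition that E is not the maximal essential subtuple of A itself; for that E, dim E = min dim A, and no essential facing of A has larger dimension, so the claim as printed fails there. *)

(* Defs.v *)
From HB Require Import structures.
From mathcomp Require Import all_boot all_order all_algebra.
From mathcomp Require Import boolp classical_sets reals.

Set Implicit Arguments.
Unset Strict Implicit.
Unset Printing Implicit Defensive.

Import Order.TTheory GRing.Theory Num.Theory.

Local Open Scope classical_set_scope.
Local Open Scope ring_scope.

Section Polytopes.
Context {R : realType} {n : nat}.
Local Notation V := 'rV[R]_n.

(* Polytopes are nonempty: the hull of at least one point. *)
Definition polytope (P : set V) : Prop :=
  exists (m : nat) (v : 'I_m.+1 -> V),
    P = [set x | exists w : 'I_m.+1 -> R,
           [/\ forall i, 0 <= w i, \sum_i w i = 1 & x = \sum_i w i *: v i]].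

(* [l = 0] gives [F = P], so a polytope is a face of itself; the empty set is
   not a face of a polytope. *)
Definition face (F P : set V) : Prop :=
  exists l : {scalar V}, F = [set x | P x /\ forall y, P y -> l y <= l x].

(* Dimension of the affine hull: the largest [k] such that [P] contains [k + 1]
   affinely independent points. *)
Definition pdim (P : set V) : nat :=
  \max_(k < n.+1 |
        `[< exists (x : V) (e : k.-tuple V),
              [/\ P x, forall i, P (x + tnth e i) & free e] >]) k.

End Polytopes.

Section Tuples.
Context {R : realType} {n : nat}.
Local Notation V := 'rV[R]_n.

Definition msum (I : finType) (A : I -> set V) : set V :=
  [set x | exists2 p : I -> V, forall i, A i (p i) & x = \sum_i p i].

Definition tdim (I : finType) (A : I -> set V) : int :=
  (pdim (msum A))%:Z - #|I|%:Z.

Definition subtuple (I : finType) (A : I -> set V) (J : {set I}) :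
  {i : I | i \in J} -> set V := fun i => A (val i).
Arguments subtuple {I} A J i.

(* The initial value of the iterated minimum is the term [J = set0]. *)
Definition mindim (I : finType) (A : I -> set V) : int :=
  \big[Order.min/tdim (subtuple A (finset.set0 : {set I}))]_(J : {set I})
     tdim (subtuple A J).

Definition essential (I : finType) (A : I -> set V) : bool :=
  [forall J : {set I},
     (tdim (subtuple A J) == mindim A) ==> (J == [set: I]%SET)].

Definition tface (I : finType) (B A : I -> set V) : Prop :=
  (forall i, face (B i) (A i)) /\ face (msum B) (msum A).

End Tuples.
Arguments subtuple {R n I} A J i.

(* Tuples indexed by a subset of [K]; [tag E] is the index set and [tagged E]
   the family itself. *)
Definition stuple (R : realType) (n : nat) (K : finType) : Type :=
  {J : {set K} & {i : K | i \in J} -> set 'rV[R]_n}.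

Section Facings.
Context {R : realType} {n : nat} {K : finType}.
Local Notation tuple := (K -> set 'rV[R]_n).

Definition max_essential_subtuple (E : stuple R n K) (A : tuple) : Prop :=
  exists2 J : {set K},
    maxset (fun J' : {set K} => essential (subtuple A J')) J &
    E = existT _ J (subtuple A J).

Definition essential_facing (E : stuple R n K) (A : tuple) : Prop :=
  exists2 B : tuple, tface B A & max_essential_subtuple E B.

Definition adjacent (A : tuple) (E E' : stuple R n K) : Prop :=
  exists B B' : tuple,
    [/\ tface B B', tface B' A,
        max_essential_subtuple E B & max_essential_subtuple E' B'].

End Facings.

(* Main.v *)
Require Import Defs.
From HB Require Import structures.
From mathcomp Require Import all_boot all_order all_algebra.
From mathcomp Require Import boolp classical_sets reals.
From mathcomp Require Import zify ring lra.

Set Implicit Arguments.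
Unset Strict Implicit.
Unset Printing Implicit Defensive.

Import Order.TTheory GRing.Theory Num.Theory.

Local Open Scope classical_set_scope.
Local Open Scope ring_scope.

(** Write every polytope as the hull of finitely many labelled points. The face
    of the tuple selected by a linear form [l] is then the set of labels where
    [l] is maximal within its polytope ([top]), and every face of the tuple is
    of this form ([tface_hull]). For a face [s] and an index set [M] let
    [rk s M] be the dimension of the Minkowski sum of the polytopes in [M], and
    call [rk s M - #|M|] the height of [M]. Since [rk] is submodular, the index
    sets of minimal height are closed under unions and intersections; the
    maximal essential subtuple of [s] is indexed by the least of them, and its
    dimension is the minimal height ([maxset_essential]).

    Let [E], indexed by [J], be the maximal essential subtuple of a face, with
    height [m]. One looks for a face above a face with facing [E] whose minimal
    height is [m + 1]. The ambient tuple has minimal height at least [m + 1],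
    for at height [m] it would have the facing [E] too
    ([least_minimizer_lift]). If its minimal height is at least [m + 2], pass to
    a smaller face and use induction. When this is impossible, every proper face
    above a face with facing [E] again has the facing [E]. Hence the set [T] of
    the linear forms selecting a face with facing [E] is a union of relatively
    open cones of the normal fan that is closed inside the open half space
    [0 < dot l v], where [v] joins a point outside [E] to a point of [E].

    This contradicts a balancing property. Modulo the directions of [E], the
    set [T] is the part of a stable intersection of tropical hypersurfaces
    lying in the normal cone of [E]. Near each of its points such a set escapes
    from every half space whose normal is not a direction of the largest index
    set of minimal height ([escape_greatest_minimizer]). So a linear function
    that is nonpositive on a connected component of [T] is proportional to [v]
    there ([bounded_proportional]). Let [M] be the least index set of minimal
    height whose directions contain all vectors killed by the component. The
    face of every polytope in [M] is the same throughout the component, so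
    differences of a point of such a polytope and a point of its face are
    nonpositive on it, hence killed up to a multiple of [v]. Thus on passing from the
    face to the ambient tuple the directions of [M] grow at most by [v]
    ([thin_minimizer]), and [M] has height at most [m + 1] in the ambient tuple.

    The balancing property is itself proved by induction on the number of
    polytopes outside the largest index set of minimal height: if adding one
    more polytope destroyed all candidates, that polytope would be constant on
    the candidates for the remaining ones, and [thin_minimizer] would produce
    an index set of minimal height that contains it. *)

(** * Linear forms *)

Section Dot.
Context {R : realFieldType} {n : nat}.
Local Notation V := 'rV[R]_n.

Definition dot (l x : V) : R := (x *m l^T) 0 0.

Fact dot_is_linear l : linear (dot l : V -> R^o).
Proof. by move=> a x y; rewrite /dot mulmxDl -scalemxAl !mxE. Qed.
HB.instance Definition _ l :=
  GRing.isLinear.Build R V R^o *:%R (dot l : V -> R^o) (dot_is_linear l).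

Lemma dotBr l x y : dot l (x - y) = dot l x - dot l y.
Proof. exact: (linearB (dot l : {linear V -> R^o})). Qed.
Lemma dotZr l a x : dot l (a *: x) = a * dot l x.
Proof. exact: (linearZ_LR (dot l : {linear V -> R^o})). Qed.
Lemma dotDl l m x : dot (l + m) x = dot l x + dot m x.
Proof. by rewrite /dot linearD mulmxDr mxE. Qed.
Lemma dotZl a l x : dot (a *: l) x = a * dot l x.
Proof. by rewrite /dot linearZ -scalemxAr mxE. Qed.
Lemma dotNl l x : dot (- l) x = - dot l x.
Proof. by rewrite -scaleN1r dotZl mulN1r. Qed.
Lemma dot0l x : dot 0 x = 0.
Proof. by rewrite -[0 : V](scale0r 0) dotZl mul0r. Qed.

Definition dotE := (dotBr, dotZr, dotDl, dotZl, dotNl, dot0l).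

Definition perp (l : V) : {vspace V} := lker (linfun (dot l : V -> R^o)).

Lemma mem_perp l x : (x \in perp l) = (dot l x == 0).
Proof. by rewrite memv_ker lfunE. Qed.

Lemma perpP l x : reflect (dot l x = 0) (x \in perp l).
Proof. by rewrite mem_perp; apply: eqP. Qed.

Lemma dot_separates (U : {vspace V}) (u : V) :
  u \notin U -> exists2 l, (U <= perp l)%VS & 0 < dot l u.
Proof.
move=> uD; set f : 'End(V) := (\1 - projv U)%VF.
have fD x : x \in U -> f x = 0.
  by move=> xD; rewrite add_lfunE opp_lfunE id_lfunE projv_id // subrr.
have fu : f u != 0.
  apply: contra uD => /eqP; rewrite add_lfunE opp_lfunE id_lfunE => /eqP.
  by rewrite subr_eq0 => /eqP ->; exact: memv_proj.
have [j fuj] : exists j, f u 0 j != 0.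
  apply/existsP; apply: contra_neqT fu => /existsPn H.
  by apply/rowP => j; rewrite mxE; apply/eqP; rewrite -[_ == _]negbK.
pose l : V := \row_k f (delta_mx 0 k) 0 j.
have lE x : dot l x = f x 0 j.
  rewrite {2}(row_sum_delta x) linear_sum summxE /dot mxE.
  by apply: eq_bigr => k _; rewrite linearZ !mxE.
have [fp|fn|f0] := ltrgt0P (f u 0 j).
- exists l; last by rewrite lE.
  by apply/subvP => x xD; apply/perpP; rewrite lE fD // mxE.
- exists (- l); last by rewrite dotNl lE oppr_gt0.
  by apply/subvP => x xD; apply/perpP; rewrite dotNl lE fD // mxE oppr0.
- by rewrite f0 eqxx in fuj.
Qed.

Definition near0 (Q : R -> Prop) :=
  exists2 e0 : R, 0 < e0 & forall e, 0 < e -> e < e0 -> Q e.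

Lemma near0_and (P Q : R -> Prop) :
  near0 P -> near0 Q -> near0 (fun e => P e /\ Q e).
Proof.
move=> [a a0 Pa] [b b0 Qb]; exists (Num.min a b); first by rewrite lt_min a0.
by move=> e e0; rewrite lt_min => /andP[ea eb]; split; [exact: Pa|exact: Qb].
Qed.

Lemma near0_impl (P Q : R -> Prop) :
  (forall e, 0 < e -> P e -> Q e) -> near0 P -> near0 Q.
Proof. by move=> PQ [a a0 Pa]; exists a => // e e0 ea; apply: PQ (Pa e e0 ea). Qed.

Lemma near0_ex (P : R -> Prop) : near0 P -> exists2 e, 0 < e & P e.
Proof.
by move=> [a a0 Pa]; exists (a / 2); [|apply: Pa]; lra.
Qed.

Lemma near0_all (I : finType) (Q : I -> R -> Prop) :
  (forall i, near0 (Q i)) -> near0 (fun e => forall i, Q i e).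
Proof.
move=> nQ; suff : near0 (fun e => forall i, i \in enum I -> Q i e).
  by apply: near0_impl => e _ H i; apply: H; rewrite mem_enum.
elim: (enum I) => [|i r IH]; first by exists 1.
apply: near0_impl (near0_and (nQ i) IH) => e _ [Qi Qr] j.
by rewrite inE => /orP[/eqP->|/Qr].
Qed.

Lemma near0_pos (a b : R) : 0 < a -> near0 (fun e => 0 < a + e * b).
Proof.
move=> a0; have d0 : 0 < `|b| + 1 by rewrite ltr_wpDl.
exists (a / (`|b| + 1)); first by rewrite divr_gt0.
move=> e e0; rewrite ltr_pdivlMr // => H.
have := ler_norm (- b); rewrite normrN => Hb.
have : e * - b <= e * `|b| by rewrite ler_pM2l.
nra.
Qed.

(** The ratio test of the simplex method: among finitely many positive affine
    functions of [t] of which one decreases, follow [t] until the first zero. *)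
Lemma first_exit (I : finType) (P : pred I) (a b : I -> R) :
  (forall i, P i -> 0 < a i) -> (exists2 i, P i & b i < 0) ->
  exists2 t, 0 < t & (forall i, P i -> 0 <= a i + t * b i) /\
    exists2 i, P i & a i + t * b i = 0.
Proof.
move=> aP [i0 Pi0 bi0].
have Q0 : [pred i | P i && (b i < 0)] i0 by rewrite /= Pi0.
case: (@Order.TotalTheory.arg_minP _ _ _ i0 [pred i | P i && (b i < 0)]
  (fun i => a i / - b i) Q0) => j /= /andP[Pj bj] Hmin.
have aj := aP _ Pj; have nbj : 0 < - b j by rewrite oppr_gt0.
exists (a j / - b j); first by rewrite divr_gt0.
split; last first.
  by exists j => //; have bj0 := ltr0_neq0 bj; field.
move=> i Pi; have ai := aP _ Pi.
have [bi|bi] := ltP (b i) 0; last first.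
  by apply: addr_ge0; [exact: ltW|apply: mulr_ge0 => //; rewrite divr_ge0 // ltW].
have /Hmin H : P i && (b i < 0) by rewrite Pi.
have nbi : 0 < - b i by rewrite oppr_gt0.
move: H; rewrite ler_pdivlMr // => H; lra.
Qed.

End Dot.

(** * Faces of a configuration of labelled points *)

Section Full.
Context {K X : finType} (o : X -> K).
(** The label [x] is a point [pos x] of the polytope [o x]; every polytope has to
    be nonempty. *)
Definition full (s : {set X}) := forall i, exists2 x, x \in s & o x = i.
End Full.

(** The labels of the face that [l] selects. The definitions below are sealed
    because comparing two faces up to conversion is very expensive. *)
HB.lock Definition top (R : realFieldType) (n : nat) (K X : finType) (o : X -> K)
    (pos : X -> 'rV[R]_n) (s : {set X}) (l : 'rV[R]_n) : {set X} :=
  [set x in s | [forall y in s,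
     (o y == o x) ==> (dot l (pos y) <= dot l (pos x))]]%SET.

(** The linear direction of the affine hull of the [i]-th polytope. *)
HB.lock Definition dir1 (R : realFieldType) (n : nat) (K X : finType) (o : X -> K)
    (pos : X -> 'rV[R]_n) (s : {set X}) (i : K) : {vspace 'rV[R]_n} :=
  <<[seq pos p.1 - pos p.2 | p <- enum [set p : X * X |
       [&& p.1 \in s, p.2 \in s, o p.1 == i & o p.2 == i]]%SET]>>%VS.

HB.lock Definition dir (R : realFieldType) (n : nat) (K X : finType) (o : X -> K)
    (pos : X -> 'rV[R]_n) (s : {set X}) (M : {set K}) : {vspace 'rV[R]_n} :=
  (\sum_(i in M) dir1 o pos s i)%VS.

HB.lock Definition rk (R : realFieldType) (n : nat) (K X : finType) (o : X -> K)
    (pos : X -> 'rV[R]_n) (s : {set X}) (M : {set K}) : nat := \dim (dir o pos s M).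

(** [J] has the least height [rk - #|J|] among the subsets of [H]; the heights
    are compared without subtraction. *)
HB.lock Definition minimizer (R : realFieldType) (n : nat) (K X : finType) (o : X -> K)
    (pos : X -> 'rV[R]_n) (s : {set X}) (H J : {set K}) : bool :=
  (J \subset H) && [forall M : {set K}, (M \subset H) ==>
     (rk o pos s J + #|M| <= rk o pos s M + #|J|)%N].

Section Configurations.
Context {R : realFieldType} {n : nat} {K X : finType}.
Local Notation V := 'rV[R]_n.
Context (o : X -> K) (pos : X -> V).
Local Notation top := (top o pos).
Local Notation dir1 := (dir1 o pos).
Local Notation dir := (dir o pos).
Local Notation rk := (rk o pos).
Local Notation minimizer := (minimizer o pos).
Local Notation full := (full o).
Implicit Types (s t : {set X}) (l : V) (i : K) (J M N H : {set K}).

Lemma topP s l x :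
  reflect (x \in s /\ forall y, y \in s -> o y = o x -> dot l (pos y) <= dot l (pos x))
    (x \in top s l).
Proof.
rewrite top.unlock inE; apply: (iffP andP) => -[xs H]; split => //.
  by move=> y ys oyx; move/forall_inP/(_ y ys)/implyP: H; apply; apply/eqP.
by apply/forall_inP => y ys; apply/implyP => /eqP; exact: H.
Qed.

Lemma top_sub s l : (top s l \subset s)%SET.
Proof. by apply/fintype.subsetP => x /topP[]. Qed.

Lemma top_in s l x : x \in top s l -> x \in s.
Proof. by move/topP=> []. Qed.

Lemma top_full s l : full s -> full (top s l).
Proof.
move=> fs i; have [x0 x0s ox0] := fs i.
have Q0 : [pred x | (x \in s) && (o x == i)] x0 by rewrite /= x0s ox0 eqxx.
case: (@Order.TotalTheory.arg_maxP _ _ _ x0 [pred x | (x \in s) && (o x == i)]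
  (fun x => dot l (pos x)) Q0) => x /= /andP[xs /eqP oxi] Hmax.
exists x => //; apply/topP; split=> // y ys oyx; apply: Hmax.
by rewrite ys oyx oxi eqxx.
Qed.

Lemma top_eq s l x y : x \in top s l -> y \in top s l -> o x = o y ->
  dot l (pos x) = dot l (pos y).
Proof.
move=> /topP[xs Hx] /topP[ys Hy] oxy; apply/eqP; rewrite eq_le.
by rewrite Hx // Hy.
Qed.

Lemma top_ge s l x y : x \in s -> y \in top s l -> o x = o y ->
  dot l (pos y) <= dot l (pos x) -> x \in top s l.
Proof.
move=> xs /topP[ys Hy] oxy lyx; apply/topP; split=> // z zs oz.
by apply: le_trans lyx; apply: Hy => //; rewrite oz.
Qed.

Lemma top_lt s l x y : x \in s -> x \notin top s l -> y \in top s l -> o x = o y ->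
  dot l (pos x) < dot l (pos y).
Proof. by move=> xs xt yt oxy; rewrite ltNge; apply: contra xt; exact: top_ge. Qed.

Lemma top0 s : top s 0 = s.
Proof.
apply/setP => x; apply/topP/idP => [[]//|xs]; split=> // y _ _.
by rewrite !dot0l.
Qed.

(** A face of [s] contained in another face is a face of that face. *)
Lemma top_top s l m : full s -> (top s m \subset top s l)%SET ->
  top (top s l) m = top s m.
Proof.
move=> fs sub; apply/setP => x; apply/idP/idP.
- move=> xt; have [y yt oy] := top_full m fs (o x).
  apply: (top_ge _ yt); [exact: top_in (top_in xt)|by []|].
  case/topP: xt => _; apply=> //; exact: (fintype.subsetP sub).
- move=> xt; apply/topP; split; first exact: (fintype.subsetP sub).
  by move=> y /top_in ys; case/topP: xt => _; apply.
Qed.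

(** A face of a face is a face: perturb the first linear form by a small multiple
    of the second. *)
Lemma top_perturb s l m : near0 (fun e => top s (l + e *: m) = top (top s l) m).
Proof.
have : near0 (fun e => forall p : X * X, dot l (pos p.1) < dot l (pos p.2) ->
    dot (l + e *: m) (pos p.1) < dot (l + e *: m) (pos p.2)).
  apply: near0_all => -[x y] /=.
  have [lxy|_] := ltP (dot l (pos x)) (dot l (pos y)); last by exists 1.
  have : near0 (fun e => 0 < (dot l (pos y) - dot l (pos x)) +
      e * (dot m (pos y) - dot m (pos x))).
    by apply: near0_pos; rewrite subr_gt0.
  by apply: near0_impl => e _ H _; rewrite !dotE; lra.
apply: near0_impl => e e0 near; apply/setP => x; apply/topP/topP.
- move=> [xs Hx]; have xt : x \in top s l.
    apply/topP; split=> // y ys oy; rewrite leNgt; apply/negP => lxy.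
    by have := near (x, y) lxy; rewrite /= ltNge Hx.
  split=> // y yt oy; have := Hx y (top_in yt) oy.
  by rewrite !dotE (top_eq xt yt) // lerD2l ler_pM2l.
- move=> [xt Hx]; split; first exact: top_in xt.
  move=> y ys oy; have [yt|yt] := boolP (y \in top s l).
    by rewrite !dotE (top_eq xt yt) // lerD2l ler_pM2l // Hx.
  by apply/ltW/(near (y, x)) => /=; exact: top_lt yt xt oy.
Qed.

Lemma top_between s l m : full s -> (top s l \subset top s m)%SET ->
  near0 (fun e => top s (m + e *: l) = top s l).
Proof.
move=> fs sub; apply: near0_impl (top_perturb s m l) => e _ ->.
exact: top_top.
Qed.

Lemma mem_dir1 s i x y : x \in s -> y \in s -> o x = i -> o y = i ->
  pos x - pos y \in dir1 s i.
Proof.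
move=> xs ys ox oy; rewrite dir1.unlock; apply: memv_span; apply/mapP; exists (x, y) => //.
by rewrite mem_enum inE /= xs ys ox oy eqxx.
Qed.

Lemma dir1_subP s i (U : {vspace V}) :
  (forall x y, x \in s -> y \in s -> o x = i -> o y = i -> pos x - pos y \in U) ->
  (dir1 s i <= U)%VS.
Proof.
move=> H; rewrite dir1.unlock; apply/span_subvP => _ /mapP[[x y] + ->] /=.
by rewrite mem_enum inE /= => /and4P[xs ys /eqP ox /eqP oy]; exact: H.
Qed.

Lemma rkE s M : rk s M = \dim (dir s M).
Proof. by rewrite rk.unlock. Qed.

Lemma dir_subP s M (U : {vspace V}) :
  reflect (forall i, i \in M -> (dir1 s i <= U)%VS) (dir s M <= U)%VS.
Proof. rewrite dir.unlock; exact: subv_sumP. Qed.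

Lemma dir1_sub_dir s i M : i \in M -> (dir1 s i <= dir s M)%VS.
Proof. by move=> iM; apply/(dir_subP s M) => //. Qed.

Lemma dir1_mono s t i : (forall x, x \in s -> o x = i -> x \in t) ->
  (dir1 s i <= dir1 t i)%VS.
Proof. by move=> H; apply: dir1_subP => x y xs ys ox oy; apply: mem_dir1; auto. Qed.

Lemma dir_mono s t M : (forall x, x \in s -> o x \in M -> x \in t) ->
  (dir s M <= dir t M)%VS.
Proof.
move=> H; apply/dir_subP => i iM; apply: subv_trans (dir1_sub_dir t iM).
by apply: dir1_mono => x xs ox; apply: H => //; rewrite ox.
Qed.

Lemma dir_eq s t M : (forall x, o x \in M -> (x \in s) = (x \in t)) ->
  dir s M = dir t M.
Proof.
by move=> H; apply/eqP; rewrite eqEsubv; apply/andP; split; apply: dir_mono => x;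
  [move=> + oM; rewrite H|move=> + oM; rewrite H].
Qed.

Lemma dir_sub s t M : (s \subset t)%SET -> (dir s M <= dir t M)%VS.
Proof. by move=> /fintype.subsetP st; apply: dir_mono => x /st. Qed.

Lemma dirS s M N : (M \subset N)%SET -> (dir s M <= dir s N)%VS.
Proof.
by move=> /fintype.subsetP MN; apply/dir_subP => i /MN; exact: dir1_sub_dir.
Qed.

Lemma dirU s M N : dir s (M :|: N) = (dir s M + dir s N)%VS.
Proof.
apply/eqP; rewrite eqEsubv; apply/andP; split; last first.
  by rewrite subv_add !dirS ?finset.subsetUl ?finset.subsetUr.
apply/dir_subP => i /finset.setUP[] iM; apply: subv_trans (dir1_sub_dir s iM) _.
  exact: addvSl.
exact: addvSr.
Qed.

Lemma top_perp s l M : (dir (top s l) M <= perp l)%VS.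
Proof.
apply/dir_subP => i _; apply: dir1_subP => x y xt yt ox oy.
by apply/perpP; rewrite dotE (top_eq xt yt) ?subrr // ox.
Qed.

(** A form that is constant on a polytope selects all of it. *)
Lemma top_const s l M x : full s -> (dir s M <= perp l)%VS ->
  o x \in M -> (x \in top s l) = (x \in s).
Proof.
move=> fs sub oM; apply/idP/idP => [/top_in//|xs].
have [y yt oy] := top_full l fs (o x).
apply: (top_ge xs yt) => //.
have /perpP : pos y - pos x \in perp l.
  apply: (subvP (subv_trans (dir1_sub_dir s oM) sub)).
  by apply: mem_dir1 => //; exact: top_in yt.
by rewrite dotE => /eqP; rewrite subr_eq0 => /eqP->.
Qed.

Lemma dir_top_const s l M : full s -> (dir s M <= perp l)%VS ->
  dir (top s l) M = dir s M.
Proof. by move=> fs sub; apply: dir_eq => x; exact: top_const. Qed.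

Lemma rk_top_const s l M : full s -> (dir s M <= perp l)%VS ->
  rk (top s l) M = rk s M.
Proof. by move=> fs sub; rewrite !rkE dir_top_const. Qed.

Lemma rk_eq s t M : (forall x, o x \in M -> (x \in s) = (x \in t)) -> rk s M = rk t M.
Proof. by move=> H; rewrite !rkE (dir_eq H). Qed.

Lemma rk_sub s t M : (s \subset t)%SET -> (rk s M <= rk t M)%N.
Proof. by move=> st; rewrite !rkE; apply/dimvS/dir_sub. Qed.

Lemma dir_rk_eq s t M : (s \subset t)%SET -> rk s M = rk t M -> dir s M = dir t M.
Proof.
by move=> st rE; apply/eqP; rewrite eqEdim dir_sub //=; move: rE; rewrite !rkE => ->.
Qed.

(** If a subtuple keeps its dimension on a smaller face, its directions are the
    same, so the form selecting the smaller face is constant on it. With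
    [perp_agree] the subtuple itself is unchanged. *)
Lemma rk_eq_perp s l m M : (top s m \subset top s l)%SET ->
  rk (top s m) M = rk (top s l) M -> (dir (top s l) M <= perp m)%VS.
Proof. by move=> sub /(dir_rk_eq sub) <-; exact: top_perp. Qed.

Lemma perp_agree s l m M x : full s -> (top s m \subset top s l)%SET ->
  (dir (top s l) M <= perp m)%VS -> o x \in M ->
  (x \in top s m) = (x \in top s l).
Proof.
by move=> fs sub dp oM; rewrite -(top_top fs sub) (top_const (top_full l fs) dp).
Qed.

(** * Index sets of minimal height *)

Lemma minimizerP s H J : reflect (J \subset H /\
    forall M, M \subset H -> (rk s J + #|M| <= rk s M + #|J|)%N) (minimizer s H J).
Proof.
rewrite minimizer.unlock; apply: (iffP andP) => -[JH Hm]; split => //.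
  by move=> M MH; move/forallP/(_ M)/implyP: Hm; apply.
by apply/forallP => M; apply/implyP; exact: Hm.
Qed.

Lemma minimizer_sub s H J : minimizer s H J -> J \subset H.
Proof. by case/minimizerP. Qed.

Lemma minimizer_le s H J M : minimizer s H J -> M \subset H ->
  (rk s J + #|M| <= rk s M + #|J|)%N.
Proof. by case/minimizerP => _; apply. Qed.

Lemma minimizer_eq s H J M : minimizer s H J -> minimizer s H M ->
  (rk s J + #|M| = rk s M + #|J|)%N.
Proof.
move=> mJ mM; have := minimizer_le mJ (minimizer_sub mM).
have := minimizer_le mM (minimizer_sub mJ); lia.
Qed.

Lemma minimizer_intro s H J M : minimizer s H J -> M \subset H ->
  (rk s M + #|J| <= rk s J + #|M|)%N -> minimizer s H M.
Proof.
move=> mJ MH rM; apply/minimizerP; split=> // N NH; have := minimizer_le mJ NH; lia.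
Qed.

Lemma minimizer_exists s H : exists J, minimizer s H J.
Proof.
case: (@arg_minnP _ (finset.set0 : {set K}) (fun M => M \subset H)
  (fun M => rk s M + #|~: M|)%N (finset.sub0set H)) => J JH Hmin.
exists J; apply/minimizerP; split=> // M MH; have := Hmin M MH.
have := cardsC J; have := cardsC M; lia.
Qed.

(** The source of the lattice structure on minimizers: the directions of an
    intersection lie in the intersection of the directions. *)
Lemma rk_submod s J M : (rk s (J :|: M) + rk s (J :&: M) <= rk s J + rk s M)%N.
Proof.
rewrite !rkE dirU -[X in (_ <= X)%N]dimv_sum_cap leq_add2l; apply: dimvS.
by rewrite subv_cap !dirS ?finset.subsetIl ?finset.subsetIr.
Qed.

Lemma minimizerI s H J M : minimizer s H J -> minimizer s H M -> minimizer s H (J :&: M).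
Proof.
move=> mJ mM; have := minimizer_eq mJ mM.
have JMH : J :|: M \subset H by rewrite finset.subUset !(minimizer_sub mJ, minimizer_sub mM).
have := minimizer_le mJ JMH; have := rk_submod s J M; have := cardsUI J M => c r a b.
apply: (minimizer_intro mJ); last by lia.
by apply: fintype.subset_trans (finset.subsetIl _ _) (minimizer_sub mJ).
Qed.

Lemma minimizerU s H J M : minimizer s H J -> minimizer s H M -> minimizer s H (J :|: M).
Proof.
move=> mJ mM; have := minimizer_eq mJ mM.
have JMH : J :&: M \subset H.
  by apply: fintype.subset_trans (finset.subsetIl _ _) (minimizer_sub mJ).
have := minimizer_le mJ JMH; have := rk_submod s J M; have := cardsUI J M => c r a b.
apply: (minimizer_intro mJ); last by lia.
by rewrite finset.subUset !(minimizer_sub mJ, minimizer_sub mM).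
Qed.

(** For two minimizers submodularity is an equality, so the directions of the
    intersection fill the intersection of the directions. *)
Lemma minimizer_dirI s H J M : minimizer s H J -> minimizer s H M ->
  dir s (J :&: M) = (dir s J :&: dir s M)%VS.
Proof.
move=> mJ mM; apply/eqP; rewrite eqEdim subv_cap !dirS ?finset.subsetIl ?finset.subsetIr //=.
have := minimizer_eq mJ (minimizerI mJ mM); have := minimizer_eq mJ (minimizerU mJ mM).
have := minimizer_eq mJ mM; have := cardsUI J M.
have := dimv_sum_cap (dir s J) (dir s M); rewrite -dirU !rkE; lia.
Qed.

Definition greatest_minimizer s H J : Prop :=
  minimizer s H J /\ forall M, minimizer s H M -> M \subset J.

Lemma greatest_minimizer_exists s H : exists J, greatest_minimizer s H J.
Proof.
have [J0 mJ0] := minimizer_exists s H.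
case: (@arg_maxnP _ J0 (minimizer s H) (fun M => #|M|) mJ0) => J mJ Hmax.
exists J; split=> // M mM; have := Hmax _ (minimizerU mJ mM) => /= c.
have /eqP -> : J == J :|: M by rewrite eqEcard finset.subsetUl.
exact: finset.subsetUr.
Qed.

(** Passing to a face lowers every dimension. If one minimizer [J] of the face
    keeps its dimension, the minimal heights of the face and of the ambient
    configuration agree; this gives this lemma and [minimizer_down]. *)
Lemma minimizer_up s t H J : s \subset t -> minimizer s H J -> rk t J = rk s J -> minimizer t H J.
Proof.
move=> st mJ rJ; apply/minimizerP; split; first exact: minimizer_sub mJ.
by move=> M MH; rewrite rJ; have := minimizer_le mJ MH; have := rk_sub M st; lia.
Qed.

Lemma minimizer_down s t H J M : s \subset t -> minimizer s H J -> rk t J = rk s J ->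
  minimizer t H M -> minimizer s H M /\ rk s M = rk t M.
Proof.
move=> st mJ rJ mM; have := minimizer_up st mJ rJ => mtJ.
have := minimizer_eq mtJ mM; have := rk_sub M st; have := minimizer_le mJ (minimizer_sub mM).
move=> a b c; split; last by lia.
by apply: (minimizer_intro mJ (minimizer_sub mM)); lia.
Qed.

End Configurations.

(** * Connected unions of cones in an open half space *)

Lemma finite_max (R : realFieldType) (V : Type) (I : finType) (P : V -> Prop) (f : V -> I)
    (g : V -> R) :
  (forall x y, P x -> P y -> f x = f y -> g x = g y) -> (exists x, P x) ->
  exists2 x, P x & forall y, P y -> g y <= g x.
Proof.
move=> gf [x0 Px0].
pose Q := [pred i : I | `[< exists2 x, P x & f x = i >]].
have /boolp.choice [h Hh] : forall i, exists x, Q i -> P x /\ f x = i.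
  move=> i; have [/asboolP[x Px fx]|_] := boolP (Q i); first by exists x.
  by exists x0.
have Qf x : P x -> Q (f x) by move=> Px; apply/asboolP; exists x.
case: (@Order.TotalTheory.arg_maxP _ _ _ (f x0) Q (fun i => g (h i)) (Qf _ Px0)) => i Qi Hmax.
have [Pi fi] := Hh _ Qi; exists (h i) => // y Py.
have [Py' fy'] := Hh _ (Qf _ Py); rewrite -(gf _ _ Py' Py fy').
by apply: Hmax; exact: Qf.
Qed.

Section ConnectedFan.
Context {R : realFieldType} {n : nat} {K X : finType}.
Local Notation V := 'rV[R]_n.
Context (o : X -> K) (pos : X -> V).
Local Notation top := (top o pos).
Local Notation dir1 := (dir1 o pos).
Local Notation dir := (dir o pos).
Local Notation rk := (rk o pos).
Local Notation minimizer := (minimizer o pos).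
Local Notation greatest_minimizer := (greatest_minimizer o pos).
Local Notation full := (full o).
(** [T] is a set of linear forms for which [J] keeps its dimension and stays a
    minimizer. It lies in the open half space given by [v] and is closed in it
    ([T_up]): forms selecting a larger face are limits of forms selecting a
    smaller one. By [T_escape] it escapes, near each of its elements, from the
    half spaces whose normal is not a direction of a minimizer. Connectedness is
    expressed by saying that properties invariant under comparability of faces
    are constant. *)
Context (s : {set X}) (H J : {set K}) (v : V) (T : V -> Prop).
Hypothesis fs : full s.
Hypothesis T_minimizer : forall l, T l -> minimizer (top s l) H J.
Hypothesis T_rk : forall l m, T l -> T m -> rk (top s l) J = rk (top s m) J.
Hypothesis T_v : forall l, T l -> 0 < dot l v.
Hypothesis T_up : forall l m, T l -> (top s l \subset top s m)%SET -> 0 < dot m v -> T m.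
Hypothesis T_escape : forall l w, T l ->
  (forall M, minimizer (top s l) H M -> w \notin dir (top s l) M) ->
  exists2 m, 0 < dot m w & near0 (fun e => T (l + e *: m)).
Hypothesis T_connected : forall P : V -> Prop,
  (forall l m, T l -> T m -> (top s m \subset top s l)%SET -> P l <-> P m) ->
  forall l m, T l -> T m -> P l -> P m.

Lemma T_keep l m M : T l -> T m -> (top s m \subset top s l)%SET ->
  minimizer (top s l) H M ->
  [/\ minimizer (top s m) H M, dir (top s m) M = dir (top s l) M &
      (dir (top s l) M <= perp m)%VS].
Proof.
move=> Tl Tm sub mM.
have [mM' rM] := minimizer_down sub (T_minimizer Tm) (T_rk Tl Tm) mM.
by split=> //; [exact: dir_rk_eq|exact: rk_eq_perp rM].
Qed.

Section Bounded.
Variable u : V.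
Hypothesis u_le0 : forall l, T l -> dot l u <= 0.

(** Move [l] inside the slice so as to increase [u], keeping the selected labels
    maximal. The move cannot go on forever, as [u] is bounded; where it stops, a
    new label becomes maximal and the face grows. *)
Lemma increase_ratio l d : T l -> dot d v = 0 -> 0 < dot d u ->
  (forall x y, x \in top s l -> y \in top s l -> o x = o y ->
     dot d (pos x) = dot d (pos y)) ->
  exists2 t, 0 < t & T (l + t *: d) /\ (top s l \proper top s (l + t *: d))%SET.
Proof.
move=> Tl dv du dc.
have /boolp.choice [y Hy] : forall i, exists y, y \in top s l /\ o y = i.
  by move=> i; have [y ? ?] := top_full pos l fs i; exists y.
pose P x := (x \in s) && (x \notin top s l).
pose a x := dot l (pos (y (o x))) - dot l (pos x).
pose b x := dot d (pos (y (o x))) - dot d (pos x).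
have aP x : P x -> 0 < a x.
  move=> /andP[xs xt]; have [yt oy] := Hy (o x).
  by rewrite subr_gt0; apply: top_lt xs xt yt _; rewrite oy.
have up t : (forall x, P x -> 0 <= a x + t * b x) ->
    (top s l \subset top s (l + t *: d))%SET.
  move=> Pt; apply/fintype.subsetP => z zt; apply/topP; split; first exact: top_in zt.
  move=> w ws ow; rewrite !dotE; have [wt|wt] := boolP (w \in top s l).
    by rewrite (top_eq wt zt ow) (dc _ _ wt zt ow).
  have Pw : P w by rewrite /P ws.
  have [yt oy] := Hy (o w); have oyz : o (y (o w)) = o z by rewrite oy.
  have := Pt _ Pw; rewrite /a /b (top_eq yt zt oyz) (dc _ _ yt zt oyz); lra.
have vt t : 0 < dot (l + t *: d) v by rewrite !dotE dv mulr0 addr0 T_v.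
have [|t t0 [tP [x Px tx]]] := first_exit aP (b := b).
  apply/not_exists2P => nex.
  pose t := (1 - dot l u) / dot d u.
  have t0 : 0 <= t by apply: divr_ge0 (ltW du); rewrite subr_ge0 (le_trans (u_le0 Tl)).
  have /u_le0 : T (l + t *: d).
    apply: T_up Tl _ (vt t); apply: up => x Px; apply: addr_ge0; first exact/ltW/aP.
    by apply: mulr_ge0 => //; have [//|/negP] := nex x; rewrite -leNgt.
  by rewrite !dotE /t divfK ?gt_eqF // addrC subrK ler10.
exists t => //; split; first exact: T_up Tl (up _ tP) (vt t).
apply/properP; split; first exact: up.
have /andP[xs xt] := Px; exists x => //; have [yt oy] := Hy (o x).
apply: (top_ge xs (fintype.subsetP (up _ tP) _ yt)) => //.
by rewrite !dotE; move: tx; rewrite /a /b; lra.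
Qed.

(** Ratios are the values on the slice [dot l v = 1] of the cone [T]. *)
Definition ratio l := dot l u / dot l v.

Definition flat l := forall m, T m -> top s m = top s l -> ratio m = ratio l.

(** Iterating [increase_ratio] reaches a flat cone since the face grows at each
    step. Ratios of flat elements take finitely many values, so their maximum
    bounds the ratio on all of [T]: this replaces linear programming duality. *)
Lemma flat_dominates l : T l -> exists m, [/\ T m, flat m & ratio l <= ratio m].
Proof.
have [k] := ubnP #|~: top s l|; elim: k l => // k IH l lek Tl.
have [fl|nfl] := pselect (flat l); first by exists l.
have [m [Tm tml rml]] : exists m, [/\ T m, top s m = top s l & ratio m <> ratio l].
  apply: contrapT => nex; apply: nfl => m Tm tml; apply: contrapT => rml.
  by apply: nex; exists m.
pose d0 := (dot m v)^-1 *: m - (dot l v)^-1 *: l.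
have lv := T_v Tl; have mv := T_v Tm.
have d0v : dot d0 v = 0 by rewrite !dotE; field; rewrite !gt_eqF.
have d0u : dot d0 u = ratio m - ratio l by rewrite !dotE /ratio; ring.
have d0c x y : x \in top s l -> y \in top s l -> o x = o y ->
    dot d0 (pos x) = dot d0 (pos y).
  move=> xt yt oxy; rewrite !dotE (top_eq xt yt oxy).
  by rewrite -tml in xt yt; rewrite (top_eq xt yt oxy).
have [d [dv du dc]] : exists d, [/\ dot d v = 0, 0 < dot d u &
    forall x y, x \in top s l -> y \in top s l -> o x = o y ->
     dot d (pos x) = dot d (pos y)].
  have [lt|lt|eq] := ltgtP (ratio l) (ratio m).
  - by exists d0; split=> //; rewrite d0u subr_gt0.
  - exists (- d0); split; first by rewrite dotNl d0v oppr0.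
      by rewrite dotNl d0u opprB subr_gt0.
    by move=> x y xt yt oxy; rewrite !dotNl (d0c x y).
  - by case: rml.
have [t t0 [Tt prop]] := increase_ratio Tl dv du dc.
have [|m' [Tm' fm' rm']] := IH (l + t *: d) _ Tt.
  by rewrite ltnS in lek; apply: leq_trans lek; apply: proper_card; rewrite finset.properC.
exists m'; split=> //; apply: le_trans rm'.
rewrite /ratio !dotE dv mulr0 addr0 ler_pM2r ?invr_gt0 //.
by rewrite lerDl mulr_ge0 // ltW.
Qed.

(** Let [c] be the maximal ratio. Attaining it on the whole cone is invariant
    under passing to comparable faces, so it holds on all of [T]. Downwards,
    either [u - c *: v] is a direction of a minimizer, which the smaller face
    keeps, or [T_escape] leads to an element of larger ratio. Upwards, an
    element of smaller ratio would be the limit of elements of the smaller face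
    with smaller ratio. *)
Lemma bounded_proportional (l0 : V) : T l0 ->
  exists c, forall l, T l -> dot l (u - c *: v) = 0.
Proof.
move=> Tl0.
have [||l1 [Tl1 fl1] max1] := @finite_max R V _ (fun l => T l /\ flat l) (top s) ratio.
- by move=> x y [Tx fx] [Ty fy] txy; exact: fy.
- by have [m [Tm fm _]] := flat_dominates Tl0; exists m.
pose c := ratio l1; exists c.
have le_c l : T l -> dot l (u - c *: v) <= 0.
  move=> Tl; have [m [Tm fm rm]] := flat_dominates Tl; have := max1 m (conj Tm fm).
  move=> /(le_trans rm); rewrite /ratio ler_pdivrMr ?T_v // !dotE subr_le0.
  by [].
pose P l := forall m, T m -> top s m = top s l -> dot m (u - c *: v) = 0.
suff PT l : T l -> P l by move=> l Tl; exact: (PT l Tl l Tl erefl).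
move=> Tl; apply: (T_connected _ Tl1 Tl); last first.
  move=> m Tm tm; have := fl1 m Tm tm; rewrite -/c => <-.
  by rewrite !dotE /ratio divfK ?subrr // gt_eqF // T_v.
move=> {Tl}{}l m Tl Tm sub; split=> [Pl m' Tm' tm'|Pm l' Tl' tl'].
- have Pl0 := Pl l Tl erefl.
  have [[M mM wM]|nM] := pselect (exists2 M, minimizer (top s l) H M &
      (u - c *: v) \in dir (top s l) M).
    have sub' : (top s m' \subset top s l)%SET by rewrite tm'.
    have [_ _ p] := T_keep Tl Tm' sub' mM.
    by apply/perpP; exact: (subvP p).
  have [|d dw /near0_ex[e e0 Te]] := T_escape Tl (w := u - c *: v).
    by move=> M mM; apply/negP => wM; apply: nM; exists M.
  have := le_c _ Te; rewrite dotDl Pl0 dotZl add0r leNgt.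
  by rewrite mulr_gt0.
- apply/eqP; rewrite eq_le le_c //= leNgt; apply/negP => lt0.
  have sub' : (top s m \subset top s l')%SET by rewrite tl'.
  have : near0 (fun e => 0 < - dot l' (u - c *: v) + e * - dot m (u - c *: v)).
    by apply: near0_pos; rewrite oppr_gt0.
  have : near0 (fun e => 0 < dot l' v + e * dot m v).
    by apply: near0_pos; exact: T_v.
  move=> /near0_and /[apply] /near0_and /(_ (top_between fs sub')).
  case/near0_ex => e e0 [[e1 e2] te].
  have Te : T (l' + e *: m).
    by apply: T_up Tm _ _; [rewrite te|rewrite !dotE].
  by have := Pm _ Te te; move: e2; rewrite dotDl dotZl; lra.
Qed.

End Bounded.

(** The polytopes whose face is locally constant along [T]: the directions of
    a minimizer cannot shrink. *)
Definition static i := forall l, T l ->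
  exists2 M, minimizer (top s l) H M & (dir1 (top s l) i <= dir (top s l) M)%VS.

Lemma static_const i l m x : static i -> T l -> T m -> o x = i ->
  x \in top s l -> x \in top s m.
Proof.
move=> si Tl Tm ox xl.
apply: (T_connected (P := fun l => x \in top s l) _ Tl Tm) => //.
move=> {Tl Tm xl}{}l {}m Tl Tm sub; split=> [xt|]; last exact: (fintype.subsetP sub).
have [M mM DM] := si l Tl; have [_ _ p] := T_keep Tl Tm sub mM.
have [y yt oy] := top_full pos m fs i.
have /perpP : pos x - pos y \in perp m.
  apply: (subvP (subv_trans DM p)); apply: mem_dir1 => //; exact: (fintype.subsetP sub).
rewrite dotE => /eqP; rewrite subr_eq0 => /eqP xy.
by apply: (top_ge (top_in xt) yt); [rewrite ox oy|rewrite xy].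
Qed.

Let killed w := forall l, T l -> dot l w = 0.

(** By [T_escape] each vector killed by [T] is a direction of some minimizer,
    hence of the greatest one. *)
Lemma killed_dir l : T l ->
  exists2 M, minimizer (top s l) H M & forall w, killed w -> w \in dir (top s l) M.
Proof.
move=> Tl; have [M [mM maxM]] := greatest_minimizer_exists o pos (top s l) H.
exists M => // w kw; apply: contrapT => /negP wM.
have [|d dw /near0_ex[e e0 Te]] := T_escape Tl (w := w).
  move=> N mN; apply: contra wM; apply/subvP; apply: dirS; exact: maxM.
by have := kw _ Te; rewrite dotDl kw // dotZl add0r => H0; move: (mulr_gt0 e0 dw); rewrite H0 ltxx.
Qed.

(** The least minimizer having all killed vectors among its directions. Unlike
    the greatest minimizer it does not change along [T], which makes its
    polytopes static. *)
Let least l M := [/\ minimizer (top s l) H M,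
  forall w, killed w -> w \in dir (top s l) M &
  forall N, minimizer (top s l) H N -> (forall w, killed w -> w \in dir (top s l) N) ->
    M \subset N].

Lemma least_exists l : T l -> exists M, least l M.
Proof.
move=> Tl; have [M0 mM0 kM0] := killed_dir Tl.
pose Q := [pred M : {set K} | minimizer (top s l) H M &&
  `[< forall w, killed w -> w \in dir (top s l) M >]].
have Q0 : Q M0 by rewrite /= mM0; apply/asboolP.
case: (@arg_minnP _ M0 Q (fun M => #|M|) Q0) => M /andP[mM /asboolP kM] Hmin.
exists M; split=> // N mN kN.
have : Q (M :&: N).
  rewrite /= minimizerI //=; apply/asboolP => w kw.
  by rewrite (minimizer_dirI mM mN) memv_cap kM // kN.
move=> /Hmin le; have /eqP <- : M :&: N == M by rewrite eqEcard finset.subsetIl.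
exact: finset.subsetIr.
Qed.

Lemma least_uniq l M N : least l M -> least l N -> M = N.
Proof.
by move=> [mM kM lM] [mN kN lN]; apply/eqP; rewrite finset.eqEsubset lM // lN.
Qed.

(** A competitor on the smaller face may be intersected with [M]; subtuples of
    [M] are the same on both faces. *)
Lemma least_down l m M : T l -> T m -> (top s m \subset top s l)%SET ->
  least l M -> least m M.
Proof.
move=> Tl Tm sub [mM kM lM]; have [mM' dM p] := T_keep Tl Tm sub mM.
split=> //; first by rewrite dM.
move=> N mN kN.
have dE : dir (top s m) (M :&: N) = dir (top s l) (M :&: N).
  apply: dir_eq => x /finset.setIP[oM _]; exact: perp_agree p oM.
have mMN := minimizerI mM' mN.
have : minimizer (top s l) H (M :&: N).
  apply: (minimizer_intro mM); first exact: minimizer_sub mMN.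
  have := minimizer_eq mMN mM'; rewrite !rkE dE dM; lia.
move=> /lM MN; apply: fintype.subset_trans (finset.subsetIr M N).
apply: MN => w kw; rewrite -dE (minimizer_dirI mM' mN) memv_cap kN // dM kM //.
Qed.

(** The point [z] of the face of a static polytope stays in its face along [T],
    so [pos x - pos z] is nonpositive on [T], hence proportional to [v] there,
    hence a direction of [M] up to a multiple of [v]. *)
Lemma thin_minimizer l0 : T l0 -> exists2 M, minimizer (top s l0) H M &
  forall i, i \in M \/ static i -> (dir1 s i <= dir (top s l0) M + <[v]>)%VS.
Proof.
move=> Tl0; have [M lM] := least_exists Tl0.
have TM l : T l -> least l M.
  move=> Tl; apply: (T_connected (P := fun l => least l M) _ Tl0 Tl) => //.
  move=> {Tl}{}l m Tl Tm sub; split; first exact: least_down.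
  move=> lmM; have [N lN] := least_exists Tl.
  by rewrite (least_uniq lmM (least_down Tl Tm sub lN)).
have [mM kM _] := lM; exists M => // i iMs.
have si : static i.
  case: iMs => // iM l /TM[mMl _ _]; exists M => //; exact: dir1_sub_dir.
have [z zt oz] := top_full pos l0 fs i.
have key x : x \in s -> o x = i -> pos x - pos z \in (dir (top s l0) M + <[v]>)%VS.
  move=> xs ox; have [|c Hc] := @bounded_proportional (pos x - pos z) _ l0 Tl0.
    move=> l Tl; rewrite dotE subr_le0.
    have zl := static_const si Tl0 Tl oz zt.
    by case/topP: zl => _; apply; rewrite // ox.
  rewrite -(subrK (c *: v) (pos x - pos z)); apply: memv_add; first exact: kM.
  by apply: memvZ; exact: memv_line.
apply: dir1_subP => x y xs ys ox oy.
by rewrite -(subrKA (pos z)) -[pos z - _]opprB rpredB // key.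
Qed.

End ConnectedFan.

(** * Balancing *)

Lemma dimv_add_line (F : fieldType) (V : vectType F) (U : {vspace V}) v :
  (\dim (U + <[v]>) <= \dim U + 1)%N.
Proof.
by apply: leq_trans (dimv_add_leqif U <[v]>) _; rewrite leq_add2l dim_vline leq_b1.
Qed.

Section Escape.
Context {R : realFieldType} {n : nat} {K X : finType}.
Local Notation V := 'rV[R]_n.
Context (o : X -> K) (pos : X -> V).
Local Notation top := (top o pos).
Local Notation dir1 := (dir1 o pos).
Local Notation dir := (dir o pos).
Local Notation rk := (rk o pos).
Local Notation minimizer := (minimizer o pos).
Local Notation greatest_minimizer := (greatest_minimizer o pos).
Local Notation full := (full o).
Local Notation static := (static o pos).

(** The local form of balancing: read [l] as a small displacement of the form
    selecting [s], so that [top s l] is the face selected after the move. *)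
Definition escape (s : {set X}) (H J : {set K}) := forall u, u \notin dir s J ->
  exists l, [/\ (dir s J <= perp l)%VS, minimizer (top s l) H J & 0 < dot l u].

(** Restrict [T] to a connected component, and derive the local condition
    [T_escape] from [escape] for the faces selected by elements of [T] by adding
    a small multiple of the form escaping from the half space. *)
Lemma thin_minimizer_of_escape (s : {set X}) (H J : {set K}) (v l0 : V) (T : V -> Prop) :
  full s -> T l0 ->
  (forall l, T l -> minimizer (top s l) H J) ->
  (forall l m, T l -> T m -> rk (top s l) J = rk (top s m) J) ->
  (forall l, T l -> 0 < dot l v) ->
  (forall l m, T l -> (top s l \subset top s m)%SET -> 0 < dot m v -> T m) ->
  (forall l m, T l -> (top s m \subset top s l)%SET -> 0 < dot m v ->
     minimizer (top s m) H J -> rk (top s m) J = rk (top s l) J -> T m) ->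
  (forall l N, T l -> greatest_minimizer (top s l) H N -> escape (top s l) H N) ->
  exists2 M, minimizer (top s l0) H M &
    forall i, i \in M \/ static s H T i -> (dir1 s i <= dir (top s l0) M + <[v]>)%VS.
Proof.
move=> fs Tl0 T_minimizer T_rk T_v T_up T_open esc.
pose lc (T : V -> Prop) (P : V -> Prop) :=
  forall l m, T l -> T m -> (top s m \subset top s l)%SET -> P l <-> P m.
(* The component of [l0]: no invariant property separates its elements from
   [l0]. *)
pose T' l := T l /\ forall P, lc T P -> P l0 -> P l.
have T'T l : T' l -> T l by case.
have T'l0 : T' l0 by [].
have T'up l m : T' l -> T m -> (top s l \subset top s m)%SET -> T' m.
  by move=> [Tl Pl] Tm lm; split=> // P lcP P0; apply: (lcP m l Tm Tl lm).2; exact: Pl.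
have T'dn l m : T' l -> T m -> (top s m \subset top s l)%SET -> T' m.
  by move=> [Tl Pl] Tm lm; split=> // P lcP P0; apply: (lcP l m Tl Tm lm).1; exact: Pl.
have conn0 P : lc T' P -> P l0 -> forall l, T' l -> P l.
  move=> lcP P0 l [Tl Pl]; suff [] : T' l /\ P l by [].
  apply: (Pl (fun l => T' l /\ P l)); last by split.
  move=> x y Tx Ty sub; split=> -[T'xy Pxy].
    by have T'y := T'dn _ _ T'xy Ty sub; split=> //; exact: (lcP x y T'xy T'y sub).1.
  by have T'x := T'up _ _ T'xy Tx sub; split=> //; exact: (lcP x y T'x T'xy sub).2.
have conn P : lc T' P -> forall l m, T' l -> T' m -> P l -> P m.
  move=> lcP l m T'l T'm Pl; apply: (conn0 P) => //; apply: contrapT => nP0.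
  apply: (conn0 (fun l => ~ P l) _ nP0 _ T'l Pl) => x y T'x T'y sub.
  by have := lcP x y T'x T'y sub; tauto.
have [||||||M mM HM] := @thin_minimizer R n K X o pos s H J v T' fs _ _ _ _ _ _ l0 T'l0.
- by move=> l /T'T; exact: T_minimizer.
- by move=> l m /T'T Tl /T'T; exact: T_rk.
- by move=> l /T'T; exact: T_v.
- move=> l m T'l sub vm; apply: (T'up l) => //; apply: (T_up l) => //; exact: T'T.
- move=> l w T'l wN; have Tl := T'T _ T'l.
  have [N mxN] := greatest_minimizer_exists o pos (top s l) H; have [mN maxN] := mxN.
  have [m [Nm mmN wm]] := esc l N Tl mxN w (wN _ mN).
  exists m => //; have mJ := T_minimizer _ Tl; have JN := maxN _ mJ.
  have rN : rk (top (top s l) m) N = rk (top s l) N.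
    by rewrite rk_top_const //; exact: top_full.
  have rJ : rk (top (top s l) m) J = rk (top s l) J.
    rewrite rk_top_const //; first exact: top_full.
    by apply: subv_trans Nm; exact: dirS.
  have : near0 (fun e => 0 < dot l v + e * dot m v) by apply: near0_pos; exact: T_v.
  move=> /(near0_and (top_perturb o pos s l m)); apply: near0_impl => e e0 [te ve].
  apply: (T'dn _ _ T'l); last by rewrite te top_sub.
  apply: (T_open l _ Tl); rewrite ?te //; [exact: top_sub|by rewrite dotDl dotZl|].
  apply: (minimizer_intro mmN); first exact: minimizer_sub mJ.
  by rewrite rN rJ (minimizer_eq mJ mN).
- exact: conn.
exists M => // i iMs; apply: HM; case: iMs => [|si]; [by left|right].
by move=> l /T'T; exact: si.
Qed.

(** Balancing of stable intersections. Remove one index [h] outside [J] from [H]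
    and take the set [T] of the forms that the induction hypothesis provides. If
    [J] ceased to be a minimizer on returning [h] to [H] for all of them, then on
    each of their faces the directions of [h] would lie in those of a minimizer.
    So [h] would be static, and [thin_minimizer_of_escape] with [v = u] would
    give a minimizer of [s] containing [h], although [J] is the greatest. *)
Lemma escape_greatest_minimizer (s : {set X}) (H J : {set K}) :
  full s -> greatest_minimizer s H J -> escape s H J.
Proof.
have [k] := ubnP #|H :\: J|; elim: k H J s => // k IH H J s lek fs [mJ maxJ] u uJ.
have JH := minimizer_sub mJ.
have [HJ|/set0Pn[h]] := eqVneq (H :\: J) finset.set0.
  have [l lJ lu] := dot_separates uJ; exists l; split=> //.
  apply/minimizerP; split=> // M MH; have MJ : M \subset J.
    apply: fintype.subset_trans MH _; by rewrite -finset.setD_eq0 HJ.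
  rewrite !rk_top_const //; first exact: minimizer_le mJ MH.
  by apply: subv_trans lJ; exact: dirS.
rewrite finset.in_setD => /andP[hJ hH]; pose H' := H :\ h.
have H'H : H' \subset H by apply: finset.subD1set.
have JH' : J \subset H' by rewrite finset.subsetD1 JH.
have mJ' : minimizer s H' J.
  by apply/minimizerP; split=> // M MH'; apply: minimizer_le mJ _; exact: fintype.subset_trans H'H.
have maxJ' M : minimizer s H' M -> M \subset J.
  move=> mM; apply: maxJ; apply: (minimizer_intro mJ).
    exact: fintype.subset_trans (minimizer_sub mM) H'H.
  by rewrite (minimizer_eq mM mJ').
have hH' : h \notin H' by rewrite !inE eqxx.
(* The induction hypothesis is also used at the faces selected by [T], whose
   greatest minimizer may be larger than [J]. *)
have ltH' (N : {set K}) : J \subset N -> (#|H' :\: N| < k)%N.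
  move=> JN; rewrite ltnS in lek; apply: leq_trans lek; apply: proper_card.
  apply/properP; split; first exact: finset.setDSS.
  by exists h; rewrite !inE ?hJ // eqxx andbF.
pose T l := [/\ (dir s J <= perp l)%VS, minimizer (top s l) H' J & 0 < dot l u].
have [l0 Tl0] : exists l, T l.
  by have [l] := IH H' J s (ltH' _ (fintype.subxx _)) fs (conj mJ' maxJ') u uJ; exists l.
have [//|nex] := pselect (exists l,
  [/\ (dir s J <= perp l)%VS, minimizer (top s l) H J & 0 < dot l u]).
have rT l : (dir s J <= perp l)%VS -> rk (top s l) J = rk s J.
  by move=> lJ; rewrite rk_top_const.
have [||||||M mM HM] := @thin_minimizer_of_escape s H' J u l0 T fs Tl0.
- by move=> l [].
- by move=> l m [lJ _ _] [mJ1 _ _]; rewrite !rT.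
- by move=> l [].
- move=> l m [lJ ml _] sub mu; have Jm : (dir s J <= perp m)%VS.
    apply: subv_trans (top_perp o pos s m J); rewrite -(dir_top_const fs lJ).
    exact: dir_sub.
  by split=> //; apply: minimizer_up sub ml _; rewrite !rT.
- move=> l m [lJ ml _] sub mu mm rm; split=> //.
  by rewrite -(dir_top_const fs lJ); exact: rk_eq_perp rm.
- move=> l N [lJ ml _] mxN; apply: (IH _ _ _ _ _ mxN); last exact: top_full.
  by apply: ltH'; exact: mxN.2 _ ml.
- have MH' := minimizer_sub mM.
  have sh : static s H' T h.
    move=> l [lJ ml lu].
    have [N [NH ltN]] : exists N : {set K}, N \subset H /\
        (rk (top s l) N + #|J| < rk (top s l) J + #|N|)%N.
      apply: contrapT => nN; apply: nex; exists l; split=> //.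
      apply/minimizerP; split=> // N NH; rewrite leqNgt; apply/negP => lt; apply: nN.
      by exists N.
    have hN : h \in N.
      apply: contraLR ltN => hN; rewrite -leqNgt; apply: minimizer_le ml _.
      by rewrite finset.subsetD1 NH.
    have NH' : N :\ h \subset H' by apply: finset.setSD.
    have := minimizer_le ml NH'; have := cardsD1 h N; rewrite hN => cN le1.
    have sN : N :\ h \subset N by apply: finset.subD1set.
    have dN : (rk (top s l) (N :\ h) <= rk (top s l) N)%N by rewrite !rkE; apply/dimvS/dirS.
    have rN : rk (top s l) (N :\ h) = rk (top s l) N.
      by move: ltN le1 cN dN; clear; lia.
    exists (N :\ h); first by apply: (minimizer_intro ml NH'); move: ltN cN rN; clear; lia.
    have /eqP -> : dir (top s l) (N :\ h) == dir (top s l) N.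
      by rewrite eqEdim dirS //= -!rkE rN.
    exact: dir1_sub_dir.
  suff /maxJ/fintype.subsetP/(_ h) : minimizer s H (h |: M).
    by rewrite finset.setU11 => /(_ isT); rewrite (negbTE hJ).
  have sub : (dir s (h |: M) <= dir (top s l0) M + <[u]>)%VS.
    apply/dir_subP => i /finset.setU1P[->|iM]; apply: HM; [by right|by left].
  have hM : h \notin M by apply: contra hH'; apply/fintype.subsetP.
  have le : (rk s (h |: M) <= rk (top s l0) M + 1)%N.
    by rewrite !rkE; exact: leq_trans (dimvS sub) (dimv_add_line _ _).
  have [lJ ml _] := Tl0; have := minimizer_eq mM ml; have := cardsU1 h M; rewrite hM rT //.
  move=> c e; apply: (minimizer_intro mJ); last by move: le c e; clear; lia.
  by rewrite finset.subUset finset.sub1set hH (fintype.subset_trans MH').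
Qed.
End Escape.

(** * Raising the minimal height by one *)

Section Lift.
Context {R : realFieldType} {n : nat} {K X : finType}.
Local Notation V := 'rV[R]_n.
Context (o : X -> K) (pos : X -> V).
Implicit Types (s t : {set X}) (l m : V).
Local Notation top := (top o pos).
Local Notation dir := (dir o pos).
Local Notation rk := (rk o pos).
Local Notation minimizer s J := (minimizer o pos s [set: K] J).
Local Notation full := (full o).

Definition least_minimizer (s : {set X}) (J : {set K}) :=
  minimizer s J /\ forall M, minimizer s M -> J \subset M.

Lemma least_minimizer_exists s : exists J, least_minimizer s J.
Proof.
have [J0 mJ0] := minimizer_exists o pos s [set: K].
case: (@arg_minnP _ J0 (fun J => minimizer s J) (fun M => #|M|) mJ0) => J mJ Hmin.
exists J; split=> // M mM; have := Hmin _ (minimizerI mJ mM) => c.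
have /eqP <- : J :&: M == J by rewrite eqEcard finset.subsetIl.
exact: finset.subsetIr.
Qed.

(** Being least among the minimizers is decided by the subsets of [J], hence by the
    polytopes in [J]. *)
Lemma least_minimizer_agree (s t : {set X}) (J : {set K}) :
  (forall x, o x \in J -> (x \in s) = (x \in t)) ->
  least_minimizer s J -> minimizer t J -> least_minimizer t J.
Proof.
move=> st [mJ lJ] tJ; split=> // M tM.
have JMJ : J :&: M \subset J by exact: finset.subsetIl.
have : minimizer s (J :&: M).
  apply: (minimizer_intro mJ (finset.subsetT _)).
  have rE (N : {set K}) : N \subset J -> rk s N = rk t N.
    by move=> /fintype.subsetP NJ; apply: rk_eq => x /NJ; exact: st.
  by rewrite !rE // (minimizer_eq (minimizerI tJ tM) tJ).
by move=> /lJ JJM; apply: fintype.subset_trans JJM (finset.subsetIr _ _).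
Qed.

(** If the minimal height of the larger face is that of the smaller one, a
    minimizer [M] of the larger face is one of the smaller face with the same
    dimension. So the subtuple [M], and with it [J], is the same on both. *)
Lemma least_minimizer_lift s l m (J M : {set K}) : full s ->
  (top s m \subset top s l)%SET -> least_minimizer (top s m) J ->
  (rk (top s l) M + #|J| <= rk (top s m) J + #|M|)%N ->
  minimizer (top s l) J /\ forall x, o x \in J -> (x \in top s l) = (x \in top s m).
Proof.
move=> fs sub [mJ lJ] le.
have rM := rk_sub o pos M sub; have leM := minimizer_le mJ (finset.subsetT M).
have mM : minimizer (top s m) M by apply: (minimizer_intro mJ (finset.subsetT _)); lia.
have /fintype.subsetP JM := lJ _ mM.
have pM : (dir (top s l) M <= perp m)%VS by apply: rk_eq_perp sub _; lia.
have agree x : o x \in J -> (x \in top s l) = (x \in top s m).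
  by move=> /JM oM; rewrite -(perp_agree fs sub pM oM).
by split=> //; apply: (minimizer_up sub mJ); exact: rk_eq.
Qed.

(** Induction on the face [s]. If the minimal height of [s] is too large and the
    induction hypothesis applies to no proper face, the set of forms selecting
    the facing [J] is closed in an open half space and
    [thin_minimizer_of_escape] bounds the minimal height of [s] after all. *)
Lemma exists_face_one_higher s (J : {set K}) (l1 : V) : full s -> least_minimizer (top s l1) J ->
  (forall M : {set K}, rk (top s l1) J + #|M| < rk s M + #|J|)%N ->
  exists l2 l3 : V, [/\ (top s l3 \subset top s l2)%SET,
    forall x, o x \in J -> (x \in top s l3) = (x \in top s l1),
    minimizer (top s l3) J,
    (forall M : {set K}, rk (top s l1) J + #|M| < rk (top s l2) M + #|J|)%N &
    exists M : {set K}, (rk (top s l2) M + #|J| = rk (top s l1) J + #|M| + 1)%N].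
Proof.
have [k] := ubnP #|s|; elim: k s l1 => // k IH s l1 lek fs lJ above.
have [[M eM]|nM] := pselect (exists M : {set K},
    (rk s M + #|J| = rk (top s l1) J + #|M| + 1)%N).
  exists 0, l1; rewrite top0; split=> //; [exact: top_sub|exact: lJ.1|by exists M].
pose m := rk (top s l1) J.
pose T l := minimizer (top s l) J /\ forall x, o x \in J -> (x \in top s l) = (x \in top s l1).
have rT l : T l -> rk (top s l) J = m.
  by move=> [_ ag]; exact: rk_eq.
have lT l : T l -> least_minimizer (top s l) J.
  by move=> [mJ ag]; apply: least_minimizer_agree lJ mJ => x /ag ->.
have Tl1 : T l1 by split=> //; exact: lJ.1.
have [[l2 [l3 [Tl3 sub prop above2]]]|nex] := pselect (exists l2 l3, [/\ T l3,
    (top s l3 \subset top s l2)%SET, (top s l2 \proper s)%SET &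
    (forall M : {set K}, m + #|M| < rk (top s l2) M + #|J|)%N]).
  have tt := top_top fs sub.
  have [||||l2' [l3' [sub' ag' mJ' above' exM]]] := IH (top s l2) l3.
  - by rewrite ltnS in lek; apply: leq_trans lek; exact: proper_card.
  - exact: top_full.
  - by rewrite tt; exact: lT.
  - by rewrite tt rT.
  rewrite tt rT // in ag' above' exM.
  have /near0_ex[e e0 [t2 t3]] :=
    near0_and (top_perturb o pos s l2 l2') (top_perturb o pos s l2 l3').
  exists (l2 + e *: l2'), (l2 + e *: l3'); rewrite t2 t3; split=> //.
  by move=> x oJ; rewrite ag' // Tl3.2.
have closed l l2 : T l -> (top s l \subset top s l2)%SET ->
    (top s l2 \proper s)%SET -> T l2.
  move=> Tl sub prop.
  have [M le] : exists M : {set K}, (rk (top s l2) M + #|J| <= m + #|M|)%N.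
    apply: contrapT => nle; apply: nex; exists l2, l; split=> // M.
    by rewrite ltnNge; apply/negP => le; apply: nle; exists M.
  rewrite -(rT l Tl) in le; have [mJ ag] := least_minimizer_lift fs sub (lT l Tl) le.
  by split=> // x oJ; rewrite ag // Tl.2.
have [x [xs xJ xl1]] : exists x, [/\ x \in s, o x \in J & x \notin top s l1].
  apply: contrapT => nx; have := above J; suff -> : rk s J = m by rewrite ltnn.
  apply: rk_eq => x xJ.
  apply/idP/idP => [xs|/top_in//]; apply: contrapT => /negP xl; apply: nx.
  by exists x.
have [y yt oy] := top_full pos l1 fs (o x).
pose v := pos y - pos x.
have Tv l : T l -> 0 < dot l v.
  move=> [_ ag]; rewrite dotE subr_gt0.
  by apply: (top_lt (s := s) (o := o)); rewrite ?ag ?oy.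
have [||||||M mM HM] := @thin_minimizer_of_escape R n K X o pos s [set: K] J v l1 T fs Tl1.
- by move=> l [].
- by move=> l l' Tl Tl'; rewrite !rT.
- exact: Tv.
- move=> l l2 Tl sub l2v; apply: closed Tl sub _; rewrite finset.properEneq top_sub andbT.
  apply: contraTneq l2v => tE; rewrite -leNgt dotE subr_le0.
  have : x \in top s l2 by rewrite tE.
  by case/topP => _; apply; rewrite // (top_in yt).
- move=> l l2 Tl sub l2v mJ rJ; split=> // z zJ; rewrite -(Tl.2 z zJ).
  by apply: (perp_agree fs sub _ zJ); exact: rk_eq_perp rJ.
- by move=> l N _; apply: escape_greatest_minimizer; exact: top_full.
have sub : (dir s M <= dir (top s l1) M + <[v]>)%VS.
  by apply/dir_subP => i iM; apply: HM; left.
have le : (rk s M <= rk (top s l1) M + 1)%N.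
  by rewrite !rkE; exact: leq_trans (dimvS sub) (dimv_add_line _ _).
have := minimizer_eq mM lJ.1; have := above M => a e; case: nM; exists M; lia.
Qed.

End Lift.

(** * Polytopes as hulls of labelled points *)

Lemma dot_sum (R : realFieldType) (n : nat) (I : finType) (P : pred I)
    (l : 'rV[R]_n) (F : I -> 'rV[R]_n) :
  dot l (\sum_(i | P i) F i) = \sum_(i | P i) dot l (F i).
Proof. exact: (linear_sum (dot l : {linear 'rV[R]_n -> R^o})). Qed.

Section ScalarForms.
Context {R : realFieldType} {n : nat}.

(** A copy of [dot] carrying the structure of a scalar form instead of a linear
    map into the regular module. *)
Definition dotf (l : 'rV[R]_n) : 'rV[R]_n -> R := dot l.
Fact dotf_is_scalar l : scalar (dotf l).
Proof. by move=> a x y; exact: dot_is_linear. Qed.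
HB.instance Definition _ l :=
  GRing.isLinear.Build R 'rV[R]_n R *%R (dotf l) (dotf_is_scalar l).

Lemma scalar_dot (f : {scalar 'rV[R]_n}) : exists l, forall x, f x = dot l x.
Proof.
exists (\row_j f (delta_mx 0 j)) => x.
rewrite {1}(row_sum_delta x) linear_sum /dot mxE; apply: eq_bigr => j _.
by rewrite linearZ /= !mxE.
Qed.
End ScalarForms.

Section FreeSub.
Context {F : fieldType} {V : vectType F}.
Lemma free_subseq (S : seq V) :
  exists e : seq V, [/\ {subset e <= S}, free e & <<e>>%VS = <<S>>%VS].
Proof.
elim: S => [|v S [e [eS fe sp]]]; first by exists [::]; split=> //; exact: nil_free.
have [vS|vS] := boolP (v \in <<S>>%VS).
  exists e; split=> //; first by move=> x /eS xS; rewrite inE xS orbT.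
  by rewrite sp span_cons; apply/esym/addv_idPr; rewrite -memvE.
exists (v :: e); split; last by rewrite !span_cons sp.
  by move=> x; rewrite !inE => /orP[->//|/eS->]; rewrite orbT.
by rewrite free_cons sp vS.
Qed.
End FreeSub.

Section Hull.
Context {R : realType} {n : nat} {K X : finType}.
Local Notation V := 'rV[R]_n.
Context (o : X -> K) (pos : X -> V).
Local Notation top := (top o pos).
Local Notation dir1 := (dir1 o pos).
Local Notation dir := (dir o pos).
Local Notation rk := (rk o pos).
Local Notation full := (full o).
Implicit Types (s t : {set X}) (l m : V) (i : K).

Definition weight s i (w : X -> R) :=
  [/\ forall x, 0 <= w x, forall x, w x != 0 -> x \in s /\ o x = i & \sum_x w x = 1].

Definition hull s i : set V :=
  [set z | exists2 w, weight s i w & z = \sum_x w x *: pos x].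

Lemma hull_pos s x : x \in s -> hull s (o x) (pos x).
Proof.
move=> xs; exists (fun y => (y == x)%:R); last first.
  rewrite (bigD1 x) //= eqxx scale1r big1 ?addr0 // => y /negbTE ->.
  by rewrite scale0r.
split=> [y|y|]; first by rewrite ler0n.
  by have [->|] := eqVneq y x; rewrite ?eqxx.
by rewrite (bigD1 x) //= eqxx big1 ?addr0 // => y /negbTE ->.
Qed.

Lemma hull_mono s t i : (forall x, x \in s -> o x = i -> x \in t) ->
  hull s i `<=` hull t i.
Proof.
move=> st z [w [w0 ws w1] zE]; exists w => //; split=> // x /ws[xs ox].
by split=> //; exact: st.
Qed.

Lemma hull_eq s t i : (forall x, o x = i -> (x \in s) = (x \in t)) ->
  hull s i = hull t i.
Proof.
by move=> st; apply/seteqP; split; apply: hull_mono => x + ox; rewrite st.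
Qed.

Lemma hull_le s i l c z : hull s i z ->
  (forall x, x \in s -> o x = i -> dot l (pos x) <= c) -> dot l z <= c.
Proof.
move=> [w [w0 ws w1] ->] le; rewrite dot_sum -[c]mul1r -w1 mulr_suml.
apply: ler_sum => x _; rewrite dotZr.
have [->|/ws[xs ox]] := eqVneq (w x) 0; first by rewrite !mul0r.
by rewrite ler_wpM2l // le.
Qed.

Lemma hull_ge s i l c z : hull s i z ->
  (forall x, x \in s -> o x = i -> c <= dot l (pos x)) -> c <= dot l z.
Proof.
move=> hz le; rewrite -[dot l z]opprK -dotNl lerNr; apply: (hull_le hz) => x xs ox.
by rewrite dotNl lerN2; exact: le.
Qed.

Lemma hull_diff s i y z : y \in s -> o y = i -> hull s i z -> z - pos y \in dir1 s i.
Proof.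
move=> ys oy [w [w0 ws w1] ->].
rewrite -[pos y]scale1r -w1 scaler_suml -sumrB; apply: rpred_sum => x _.
rewrite -scalerBr; have [->|/ws[xs ox]] := eqVneq (w x) 0; first by rewrite scale0r mem0v.
by apply: memvZ; exact: mem_dir1.
Qed.

Lemma face_hull s i l : full s ->
  [set x | hull s i x /\ forall y, hull s i y -> dot l y <= dot l x] = hull (top s l) i.
Proof.
move=> fs; have [y yt oy] := top_full pos l fs i.
have ley x : x \in s -> o x = i -> dot l (pos x) <= dot l (pos y).
  by move=> xs ox; case/topP: yt => _; apply; rewrite // ox.
apply/seteqP; split=> z /=.
- move=> [[w [w0 ws w1] zE] zmax].
  have le : dot l (pos y) <= dot l z by apply: zmax; rewrite -oy; apply: hull_pos; exact: top_in yt.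
  exists w => //; split=> // x wx; have [xs ox] := ws x wx; split=> //.
  have F0 x' : true -> 0 <= w x' * (dot l (pos y) - dot l (pos x')).
    have [->|/ws[xs' ox']] := eqVneq (w x') 0; first by rewrite mul0r.
    by move=> _; rewrite mulr_ge0 // subr_ge0 ley.
  have : \sum_x' w x' * (dot l (pos y) - dot l (pos x')) <= 0.
    under eq_bigr do rewrite mulrBr.
    rewrite sumrB -mulr_suml w1 mul1r subr_le0; apply: le_trans le _.
    by rewrite zE dot_sum; apply: ler_sum => x' _; rewrite dotZr.
  move=> le0; have /eqP : \sum_x' w x' * (dot l (pos y) - dot l (pos x')) = 0.
    by apply/eqP; rewrite eq_le le0 sumr_ge0.
  rewrite psumr_eq0 // => /allP/(_ x (mem_index_enum _)) /=.
  rewrite mulf_eq0 (negbTE wx) subr_eq0 => /eqP lxy.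
  by apply: (top_ge xs yt); [rewrite ox oy|rewrite lxy].
- move=> hz; split; first by apply: hull_mono hz => x /top_in.
  move=> z' hz'; apply: (@le_trans _ _ (dot l (pos y))).
    exact: hull_le hz' ley.
  apply: (hull_ge hz) => x xt ox.
  by rewrite (top_eq xt yt) // ox oy.
Qed.

Lemma tface_top s l : full s -> tface (hull (top s l)) (hull s).
Proof.
move=> fs; split=> [i|]; first by exists (dotf l); rewrite -face_hull.
exists (dotf l); apply/seteqP; split=> z /=.
- move=> [p hp ->]; split.
    by exists p => // i; apply: hull_mono (hp i) => x /top_in.
  move=> _ [q hq ->]; rewrite /dotf !dot_sum; apply: ler_sum => i _.
  by have := hp i; rewrite -face_hull //= => -[_]; apply.
- move=> [[p hp ->] pmax]; exists p => // i; rewrite -face_hull //=; split=> // y hy.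
  pose q j := if j == i then y else p j.
  have := pmax (\sum_j q j); rewrite /dotf !dot_sum => /(_ _)/wrap[].
    by exists q => // j; rewrite /q; case: eqP => [->|].
  rewrite (bigD1 i) //= [X in _ <= X](bigD1 i) //= /q eqxx.
  rewrite (eq_bigr (fun j => dot l (p j))) ?lerD2r // => j /negbTE -> //.
Qed.

(** The form [l] selecting the face of the Minkowski sum selects every component.
    Each [B i] is the face selected by some form [li i]. It lies in the face
    selected by [l], because one summand of a maximal sum can be exchanged.
    Conversely, let [x] be in the face selected by [l]. Add to it points of the
    other faces minimizing [li i]; the sum is also a sum of points of [B], and
    comparing the values of [li i] shows that [x] maximizes [li i]. *)
Lemma tface_hull s (B : K -> set V) : full s -> tface B (hull s) ->
  exists l, B = hull (top s l).
Proof.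
move=> fs [fB [f fE]]; have [l lE] := scalar_dot f; exists l.
have /boolp.choice [li liE] : forall i, exists l, B i = hull (top s l) i.
  move=> i; have [g gE] := fB i; have [m mE] := scalar_dot g; exists m.
  rewrite gE -face_hull //; apply/seteqP; split=> z /= [hz zmax]; split=> // y /zmax.
    by rewrite !mE.
  by rewrite !mE.
have /boolp.choice [b bP] : forall i, exists x, x \in top s (li i) /\ o x = i.
  by move=> i; have [x] := top_full pos (li i) fs i; exists x.
have posB x : x \in top s (li (o x)) -> B (o x) (pos x).
  by move=> xt; rewrite liE; exact: hull_pos.
have sub1 i x : o x = i -> x \in top s (li i) -> x \in top s l.
  move=> ox xt; apply/topP; split; first exact: top_in xt.
  move=> y ys oy; pose p j := if j == i then pos x else pos (b j).
  have : msum B (\sum_j p j).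
    exists p => // j; rewrite /p; case: eqP => [->|_].
      by rewrite -ox; apply: posB; rewrite ox.
    by have [bt ob] := bP j; rewrite -{1}ob; apply: posB; rewrite ob.
  rewrite fE /= => -[_ pmax].
  pose q j := if j == i then pos y else pos (b j).
  have := pmax (\sum_j q j); rewrite !lE !dot_sum => /(_ _)/wrap[].
    exists q => // j; rewrite /q; case: eqP => [->|_].
      by rewrite -ox -oy; apply: hull_pos.
    by have [bt ob] := bP j; rewrite -{1}ob; apply: hull_pos; exact: top_in bt.
  rewrite (bigD1 i) //= [X in _ <= X](bigD1 i) //= /p /q eqxx.
  rewrite (eq_bigr (fun j => dot l (pos (b j)))); last by move=> j /negbTE ->.
  rewrite [X in _ <= _ + X](eq_bigr (fun j => dot l (pos (b j)))); last by move=> j /negbTE ->.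
  by rewrite lerD2r.
apply: funext => i; rewrite liE; apply: hull_eq => x ox; apply/idP/idP; first exact: sub1.
move=> xt; have /boolp.choice [q qP] : forall j, exists y, y \in top (top s l) (- li i) /\ o y = j.
  by move=> j; have [y] := top_full pos (- li i) (top_full pos l fs) j; exists y.
pose p j := if j == i then pos x else pos (q j).
have : msum B (\sum_j p j).
  rewrite fE; split.
    exists p => // j; rewrite /p; case: eqP => [->|_].
      by rewrite -ox; apply: hull_pos (top_in xt).
    by have [qt oq] := qP j; rewrite -{1}oq; apply: hull_pos; exact: top_in (top_in qt).
  move=> _ [r hr ->]; rewrite !lE !dot_sum; apply: ler_sum => j _; rewrite /p.
  case: eqP => [ji|_].
    by apply: (hull_le (hr j)) => y ys oy; case/topP: xt => _; apply; rewrite // oy ji ox.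
  have [qt oq] := qP j; apply: (hull_le (hr j)) => y ys oy.
  by case/topP: (top_in qt) => _; apply; rewrite // oy.
move=> [r Br rE]; have [bt ob] := bP i.
apply: (top_ge (top_in xt) bt); first by rewrite ox.
have ri : dot (li i) (pos (b i)) <= dot (li i) (r i).
  have := Br i; rewrite liE => /hull_ge; apply => y yt oy.
  by rewrite (top_eq bt yt) // oy.
apply: le_trans ri _; move: rE => /(congr1 (dot (li i))); rewrite !dot_sum.
rewrite (bigD1 i) //= [in RHS](bigD1 i) //= {1}/p eqxx => rE.
have : \sum_(j | j != i) dot (li i) (p j) <= \sum_(j | j != i) dot (li i) (r j).
  apply: ler_sum => j ji; rewrite /p (negbTE ji); have [qt oq] := qP j.
  have := Br j; rewrite liE => /hull_ge; apply => y yt oy.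
  rewrite -lerN2 -!dotNl; case/topP: qt => _; apply; last by rewrite oy.
  exact: (sub1 j).
lra.
Qed.

(** The differences of points of the sum span the directions. Conversely choose
    a base point in each polytope: the differences to it generate the
    directions, a free generating subfamily has the right size, and each of its
    members moves the sum of the base points inside the sum by exchanging one
    summand. *)
Lemma pdim_msum s (I : finType) (f : I -> K) : full s ->
  pdim (msum (fun k : I => hull s (f k))) = rk s (f @: [set: I]%SET).
Proof.
move=> fs; set P := msum _; set U := dir s (f @: [set: I]%SET).
have /boolp.choice [b bP] : forall i, exists x, x \in s /\ o x = i.
  by move=> i; have [x] := fs i; exists x.
have fU (k : I) : (dir1 s (f k) <= U)%VS by apply: dir1_sub_dir; apply: imset_f; rewrite inE.
have PU y z : P y -> P z -> y - z \in U.
  move=> [p hp ->] [q hq ->]; rewrite -sumrB; apply: rpred_sum => i _.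
  apply: (subvP (fU i)); have [bs ob] := bP (f i).
  rewrite -(subrKA (pos (b (f i)))) -[pos _ - q i]opprB rpredB //; exact: hull_diff.
apply/eqP; rewrite eqn_leq; apply/andP; split.
  apply/bigmax_leqP => k /asboolP[x [e [Px Pe fe]]].
  rewrite rkE -/U; move: fe; rewrite /free size_tuple => /eqP <-; apply: dimvS.
  apply/span_subvP => v /tnthP[i ->].
  by rewrite -[tnth e i](addKr x) addrC; apply: PU.
pose S := [seq pos x - pos (b (o x)) | x <- enum [set x in s | o x \in f @: [set: I]%SET]%SET].
have spS : <<S>>%VS = U.
  apply/eqP; rewrite eqEsubv; apply/andP; split.
    apply/span_subvP => _ /mapP[x + ->]; rewrite mem_enum inE => /andP[xs fx].
    apply: (subvP (dir1_sub_dir o pos s fx)); apply: mem_dir1 => //; by have [] := bP (o x).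
  apply/dir_subP => i fi; apply: dir1_subP => x y xs ys ox oy.
  have mem z : z \in s -> o z = i -> pos z - pos (b i) \in <<S>>%VS.
    move=> zs oz; apply: memv_span; apply/mapP; exists z; last by rewrite oz.
    by rewrite mem_enum inE zs oz.
  by rewrite -(subrKA (pos (b i))) -[pos _ - pos y]opprB rpredB ?mem.
have [e [eS fe spe]] := free_subseq S.
have sz : size e = rk s (f @: [set: I]%SET).
  by rewrite rkE -/U -spS -spe; apply/esym/eqP.
have lt : (rk s (f @: [set: I]%SET) < n.+1)%N.
  rewrite ltnS rkE; have := dimvS (subvf U); rewrite dimvf /dim /= mul1n.
  by [].
rewrite -[X in (X <= _)%N]/(nat_of_ord (Ordinal lt)).
apply: (@leq_bigmax_cond _ _ (fun k : 'I_n.+1 => k : nat)).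
apply/asboolP; exists (\sum_(j : I) pos (b (f j))), (tcast sz (in_tuple e)); split.
- exists (fun j : I => pos (b (f j))) => // j; have [bs ob] := bP (f j).
  by rewrite -{1}ob; exact: hull_pos.
- move=> k; have /eS/mapP[x + ->] : tnth (tcast sz (in_tuple e)) k \in e.
    by have := mem_tnth k (tcast sz (in_tuple e)); rewrite memtE /= val_tcast.
  rewrite mem_enum inE => /andP[xs /imsetP[h _ fh]].
  exists (fun j : I => if j == h then pos x else pos (b (f j))).
    move=> j; case: eqP => [->|_]; first by rewrite -fh; exact: hull_pos.
    by have [bs ob] := bP (f j); rewrite -{1}ob; exact: hull_pos.
  rewrite (bigD1 h) //= [in RHS](bigD1 h) //= eqxx fh.
  rewrite [in RHS](eq_bigr (fun j => pos (b (f j)))); last by move=> j /negbTE ->.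
  by rewrite addrAC addrCA subrr addr0 addrC.
- by rewrite val_tcast.
Qed.

End Hull.

(** * The maximal essential subtuple *)

Section Essential.
Context {R : realType} {n : nat}.

Lemma essentialP (I : finType) (A : I -> set 'rV[R]_n) :
  reflect (forall M : {set I},
      tdim (subtuple A M) <= tdim (subtuple A [set: I]%SET) -> M = [set: I]%SET)
    (essential A).
Proof.
have le M : mindim A <= tdim (subtuple A M) by exact: bigmin_le.
have /cid[J0 eJ0] : exists J, mindim A = tdim (subtuple A J).
  apply: (big_ind (fun z => exists J, z = tdim (subtuple A J))) => [|x y [Jx ->] [Jy ->]|J _].
  - by exists finset.set0.
  - by rewrite minEle; case: ifP; [exists Jx|exists Jy].
  - by exists J.
apply: (iffP forallP) => [ess M leM|ess J].
  have JT : J0 = [set: I]%SET by apply/eqP/(implyP (ess J0)); rewrite eJ0.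
  apply/eqP/(implyP (ess M)); rewrite eq_le le andbT.
  by rewrite eJ0 JT.
by apply/implyP => /eqP eJ; apply/eqP/ess; rewrite eJ le.
Qed.

Context {K X : finType} (o : X -> K) (pos : X -> 'rV[R]_n) (s : {set X}).
Hypothesis fs : full o s.
Local Notation rk := (rk o pos).
Local Notation hull := (hull o pos).
Local Notation least_minimizer := (least_minimizer o pos).

Lemma tdim_hull (I : finType) (f : I -> K) : injective f ->
  tdim (fun k : I => hull s (f k)) =
  (rk s (f @: [set: I]%SET))%:Z - #|f @: [set: I]%SET|%:Z.
Proof.
by move=> fi; rewrite /tdim pdim_msum // card_imset // cardsT.
Qed.

Lemma tdim_subtuple (J : {set K}) :
  tdim (subtuple (hull s) J) = (rk s J)%:Z - #|J|%:Z.
Proof.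
rewrite (tdim_hull (f := val)); last exact: val_inj.
suff -> : (val @: [set: {i : K | i \in J}]%SET)%SET = J by [].
apply/setP => i; apply/imsetP/idP => [[[j jJ] _ ->//]|iJ].
by exists (exist _ i iJ).
Qed.

Lemma essential_hull (J : {set K}) :
  essential (subtuple (hull s) J) <->
  forall M : {set K}, M \subset J -> (rk s M + #|J| <= rk s J + #|M|)%N -> M = J.
Proof.
(* Subsets of the index type of the subtuple, as subsets of [J]. *)
pose up (M : {set {i : K | i \in J}}) : {set K} := (val @: M)%SET.
have upT : up [set: _]%SET = J.
  apply/setP => i; apply/imsetP/idP => [[[j jJ] _ ->//]|iJ].
  by exists (exist _ i iJ).
have upE M : tdim (subtuple (subtuple (hull s) J) M) = (rk s (up M))%:Z - #|up M|%:Z.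
  rewrite (tdim_hull (f := fun x : {x | x \in M} => val (val x))); last first.
    by move=> x y /val_inj /val_inj.
  suff -> : ((fun x : {x | x \in M} => val (val x)) @: [set: _]%SET)%SET = up M by [].
  apply/setP => i; apply/imsetP/imsetP => [[[x xM] _ ->]|[x xM ->]]; first by exists x.
  by exists (exist _ x xM).
split=> [/essentialP ess M MJ le|ess].
  pose N : {set {i : K | i \in J}} := [set x | val x \in M]%SET.
  have upN : up N = M.
    apply/setP => i; apply/imsetP/idP => [[x + ->]|iM]; first by rewrite inE.
    by exists (exist _ i (fintype.subsetP MJ _ iM)); rewrite ?inE.
  rewrite -upN (ess N) ?upT // !upE upN upT; move: le; clear; lia.
apply/essentialP => M; rewrite !upE upT => le.
have MJ : up M \subset J by rewrite -upT; apply: imsetS; exact: finset.subsetT.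
have uM : up M = J by apply: ess MJ _; move: le; clear; lia.
apply/setP => x; rewrite inE; have : val x \in up M by rewrite uM (valP x).
by case/imsetP => y yM /val_inj ->.
Qed.

(** The maximal essential subtuple is indexed by the least minimizer, which is
    essential by minimality and contains every essential [M] because [M]
    meets it in a subset of no larger height. *)
Lemma maxset_essential (J : {set K}) :
  maxset (fun M : {set K} => essential (subtuple (hull s) M)) J <-> least_minimizer s J.
Proof.
have least_ess N : least_minimizer s N -> essential (subtuple (hull s) N).
  move=> [mN lN]; apply/essential_hull => M MN le; apply/eqP.
  rewrite finset.eqEsubset MN lN //; exact: (minimizer_intro mN (finset.subsetT _)).
have ess_sub N M : least_minimizer s N -> essential (subtuple (hull s) M) -> M \subset N.
  move=> [mN lN] /essential_hull ess.
  suff <- : M :&: N = M by exact: finset.subsetIr.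
  apply: ess; first exact: finset.subsetIl.
  have := minimizer_le mN (finset.subsetT (M :|: N)).
  have := rk_submod o pos s M N; have := cardsUI M N; clear; lia.
split=> [/maxsetP[ess maxJ]|lJ].
  have [N lN] := least_minimizer_exists o pos s.
  by rewrite -(maxJ N (least_ess N lN) (ess_sub N J lN ess)).
apply/maxsetP; split=> [|M ess JM]; first exact: least_ess.
by apply/eqP; rewrite finset.eqEsubset JM (ess_sub J M).
Qed.

End Essential.

Section Vertices.
Context {R : realType} {n : nat} {K : finType}.

Lemma sum_tagged_supp (V : zmodType) (m : K -> nat) (i : K)
    (F : forall k, 'I_(m k).+1 -> V) :
  (forall k j, k != i -> F k j = 0) ->
  \sum_(x : {k : K & 'I_(m k).+1}) F (tag x) (tagged x) = \sum_j F i j.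
Proof.
move=> F0; transitivity (\sum_k \sum_(j : 'I_(m k).+1) F k j).
  by rewrite sig_big_dep.
rewrite (bigD1 i) //=.
by rewrite [X in _ + X]big1 ?addr0 // => k ki; apply: big1 => j _; exact: F0.
Qed.

Lemma polytopes_hull (A : K -> set 'rV[R]_n) :
  (forall i, polytope (A i)) ->
  exists (X : finType) (o : X -> K) (pos : X -> 'rV[R]_n),
    full o [set: X]%SET /\ A = hull o pos [set: X]%SET.
Proof.
move=> polyA.
have /boolp.choice [m Hm] : forall i, exists m, exists v : 'I_m.+1 -> 'rV[R]_n,
    A i = [set x | exists w : 'I_m.+1 -> R,
           [/\ forall j, 0 <= w j, \sum_j w j = 1 & x = \sum_j w j *: v j]].
  by move=> i; have [m [v vE]] := polyA i; exists m, v.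
pose v i := projT1 (cid (Hm i)).
have vE i : A i = [set x | exists w : 'I_(m i).+1 -> R,
    [/\ forall j, 0 <= w j, \sum_j w j = 1 & x = \sum_j w j *: v i j]].
  exact: projT2 (cid (Hm i)).
pose T k (j : 'I_(m k).+1) : {k : K & 'I_(m k).+1} := Tagged (fun k => 'I_(m k).+1) j.
exists {k : K & 'I_(m k).+1}, (fun x => tag x), (fun x => v (tag x) (tagged x)).
split; first by move=> i; exists (T i ord0); rewrite ?inE.
apply: funext => i; rewrite vE; apply/seteqP; split=> z /=.
- move=> [w [w0 w1 ->]].
  (* for [k = i] the index [inord j] is [j] itself *)
  pose W k (j : 'I_(m k).+1) : R := if k == i then w (inord j) else 0.
  have W0 k j : k != i -> W k j = 0 by rewrite /W => /negbTE ->.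
  have Wi j : W i j = w j by rewrite /W eqxx inord_val.
  exists (fun x => W (tag x) (tagged x)); first split.
  + by move=> [k j]; rewrite /W /=; case: ifP.
  + move=> [k j] /=; have [ki|/W0->] := eqVneq k i; last by rewrite eqxx.
    by rewrite inE.
  + by rewrite (sum_tagged_supp W0) -w1; apply: eq_bigr => j _; exact: Wi.
  + rewrite (@sum_tagged_supp _ m i (fun k j => W k j *: v k j)).
      by apply: eq_bigr => j _; rewrite Wi.
    by move=> k j /W0 ->; rewrite scale0r.
- move=> [w [w0 ws w1] ->]; pose W k j := w (T k j).
  have W0 k j : k != i -> W k j = 0.
    move=> ki; apply/eqP; apply: contraNT ki => /ws[_ /= ->]; exact: eqxx.
  exists (W i); split=> [j||]; first exact: w0.
    by rewrite -w1 -(sum_tagged_supp W0); apply: eq_bigr => -[].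
  rewrite -(@sum_tagged_supp _ m i (fun k j => W k j *: v k j)).
    by apply: eq_bigr => -[].
  by move=> k j /W0 ->; rewrite scale0r.
Qed.

End Vertices.

Theorem theorem2p17 (R : realType) (n : nat) (K : finType)
    (A : K -> set 'rV[R]_n) (polyA : forall i : K, polytope (A i))
    (E : stuple R n K) (facE : essential_facing E A)
    (topE : ~ max_essential_subtuple E A) :
  exists E' : stuple R n K,
    [/\ essential_facing E' A, E' <> E, adjacent A E E' &
        tdim (tagged E') = tdim (tagged E) + 1].
Proof.
have [X [o [pos [fX AE]]]] := polytopes_hull polyA.
move: topE facE; rewrite {}AE {polyA A} => topE [B tB [J maxJ EE]].
have [l1 BE] := tface_hull fX tB.
rewrite {}BE {tB} in maxJ EE.
pose S := [set: X]%SET; rewrite -/S in fX topE maxJ EE *.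
have ft l : full o (top o pos S l) by exact: top_full.
have /(maxset_essential pos (ft l1)) lJ := maxJ.
have subE (s t : {set X}) : (forall x, o x \in J -> (x \in s) = (x \in t)) ->
    subtuple (hull o pos s) J = subtuple (hull o pos t) J.
  move=> st; apply: funext => -[i iJ]; apply: hull_eq => x /= ox.
  by apply: st; rewrite ox.
(* Otherwise [E] would be the facing of the whole tuple. *)
have above (M : {set K}) :
    (rk o pos (top o pos S l1) J + #|M| < rk o pos S M + #|J|)%N.
  rewrite ltnNge; apply/negP => le; apply: topE.
  have [] := @least_minimizer_lift R n K X o pos S 0 l1 J M; rewrite ?top0 ?top_sub //.
  move=> mJ ag; exists J; last by rewrite EE; congr existT; apply: subE => x /ag.
  by apply/maxset_essential => //; apply: least_minimizer_agree lJ mJ => x /ag ->.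
have [l2 [l3 [sub ag mJ3 above2 [M eM]]]] := exists_face_one_higher fX lJ above.
have lJ3 : least_minimizer o pos (top o pos S l3) J.
  by apply: least_minimizer_agree lJ mJ3 => x /ag ->.
have [J2 lJ2] := least_minimizer_exists o pos (top o pos S l2).
pose E' : stuple R n K := existT _ J2 (subtuple (hull o pos (top o pos S l2)) J2).
have maxE' : max_essential_subtuple E' (hull o pos (top o pos S l2)).
  by exists J2; [exact: (maxset_essential pos (ft l2) J2).2 lJ2|].
have tE : tdim (tagged E') = tdim (tagged E) + 1.
  rewrite EE /= !tdim_subtuple //.
  have := minimizer_le lJ2.1 (finset.subsetT M); have := above2 J2; move: eM; clear; lia.
exists E'; split=> //.
- by exists (hull o pos (top o pos S l2)) => //; exact: tface_top.
- by move=> EE'; move: tE; rewrite EE'; clear; lia.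
- exists (hull o pos (top o pos S l3)), (hull o pos (top o pos S l2)); split=> //.
  + by rewrite -(top_top fX sub); exact: tface_top.
  + exact: tface_top.
  + exists J; first exact/maxset_essential.
    by rewrite EE; congr existT; apply: subE => x /ag.
Qed.
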